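(* Let $G=(V,E)$ be an infinite, connected, simple, quasi-transitive graph with bounded maximal degree, and let the initial water levels $\{\eta_0(u)\}_{u\in V}$ be i.i.d. random variables with the uniform distribution on $[0,1]$. Let $v\in V$ be a fixed vertex. (1) If $G$ is the (infinite) line graph, that is $V=\mathbb{Z}$ and $E=\{\langle u,u+1\rangle,\ u\in\mathbb{Z}\}$, then $\kappa(v)$ depends on the initial profile, i.e. $\kappa(v)$ is a random variable with a non-degenerate distribution (it is not almost surely constant). (2) If $G$ is not (isomorphic to) the infinite line graph, then $\kappa(v)=1$ almost surely.
   Context: Water transport: given a graph $G=(V,E)$ and an initial water profile $\{\eta_0(u)\}_{u\in V}$, in round $k\ge 1$ one chooses an edge $\langle x,y\rangle\in E$ and $\mu_k\in[0,\tfrac12]$ and sets $$\eta_k(x)=\eta_{k-1}(x)+\mu_k\,(\eta_{k-1}(y)-\eta_{k-1}(x)),\qquad \eta_k(y)=\eta_{k-1}(y)+\mu_k\,(\eta_{k-1}(x)-\eta_{k-1}(y)),$$ with $\eta_k(w)=\eta_{k-1}(w)$ for all $w\in V\setminus\{x,y\}$. A finite move sequence is a finite list $\big((e_k,\mu_k)\big)_{k=1}^T\in(E\times[0,\tfrac12])^T$, $T\in\{0,1,2,\dots\}$. For $v\in V$, $\kappa(v)$ is the supremum of all values $\eta_T(v)$ achievable from the given initial profile by finite move sequences (over all $T$). For random initial levels the move sequence may depend on the realized initial profile, so $\kappa(v)$ is a random variable. A graph automorphism of a simple graph $G=(V,E)$ is a bijection $f:V\to V$ such that $\langle f(u),f(w)\rangle\in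 E$ if and only if $\langle u,w\rangle\in E$. $G$ is quasi-transitive if $V$ can be partitioned into finitely many classes such that for any two vertices $u,w$ in the same class there is a graph automorphism $f$ with $f(u)=w$. *)

(* Defs.v *)
From mathcomp Require Import all_boot all_order all_algebra.
From mathcomp Require Import all_classical all_reals all_analysis.
From mathcomp Require Import measurable_realfun.

Set Implicit Arguments.
Unset Strict Implicit.
Unset Printing Implicit Defensive.

Import Order.TTheory GRing.Theory Num.Theory.

Local Open Scope classical_set_scope.
Local Open Scope ring_scope.

(* A graph on the vertex type V is given by its adjacency relation E. *)

Definition simple_graph (V : choiceType) (E : rel V) : Prop :=
  symmetric E /\ irreflexive E.

Definition graph_connected (V : choiceType) (E : rel V) : Prop :=
  forall u w : V, exists p : seq V, path E u p /\ last u p = w.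

Definition bounded_degree (V : choiceType) (E : rel V) : Prop :=
  exists D : nat, forall u : V, ([set w | E u w] #<= `I_D)%card.

Definition graph_isomorphism (V V' : choiceType) (E : rel V) (E' : rel V')
    (f : V -> V') : Prop :=
  bijective f /\ forall u w : V, E' (f u) (f w) = E u w.

Definition graph_isomorphic (V V' : choiceType) (E : rel V) (E' : rel V')
  : Prop := exists f : V -> V', graph_isomorphism E E' f.

Definition graph_automorphism (V : choiceType) (E : rel V) (f : V -> V) : Prop :=
  graph_isomorphism E E f.

(* The partition is encoded by a labelling c of the vertices by n classes. *)
Definition quasi_transitive (V : choiceType) (E : rel V) : Prop :=
  exists (n : nat) (c : V -> 'I_n), forall u w : V, c u = c w ->
    exists f : V -> V, graph_automorphism E f /\ f u = w.

Definition line_graph : rel int := fun u w => (w == u + 1) || (u == w + 1).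

(* A move ((x, y), mu) pours along the edge <x, y> with parameter mu; the
   update rule is symmetric in x and y, so ordered pairs represent edges. *)
Definition move (V : choiceType) (R : realType) : Type := ((V * V) * R)%type.

Definition admissible (V : choiceType) (E : rel V) (R : realType)
    (m : move V R) : bool :=
  E m.1.1 m.1.2 && (0 <= m.2 <= 2^-1).

Definition water_step (V : choiceType) (R : realType)
    (eta : V -> R) (m : move V R) : V -> R :=
  let: ((x, y), mu) := m in
  fun w => if w == x then eta x + mu * (eta y - eta x)
           else if w == y then eta y + mu * (eta x - eta y)
           else eta w.

Definition water_run (V : choiceType) (R : realType)
    (eta0 : V -> R) (ms : seq (move V R)) : V -> R :=
  foldl (@water_step V R) eta0 ms.

(* The supremum is taken in \bar R since an arbitrary profile eta0 may be
   unbounded. *)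
Definition kappa (V : choiceType) (E : rel V) (R : realType)
    (eta0 : V -> R) (v : V) : \bar R :=
  ereal_sup [set (water_run eta0 ms v)%:E |
             ms in [set ms : seq (move V R) | all (@admissible V E R) ms]].

Definition mutually_independent (V : choiceType) (d : measure_display)
    (T : measurableType d) (R : realType) (P : probability T R)
    (X : V -> {RV P >-> R}) : Prop :=
  forall (s : seq V) (A : V -> set R), uniq s ->
    (forall u, measurable (A u)) ->
    P (\bigcap_(u in [set` s]) (X u @^-1` A u)) =
    (\prod_(u <- s) P (X u @^-1` A u))%E.

Definition iid_uniform01 (V : choiceType) (d : measure_display)
    (T : measurableType d) (R : realType) (P : probability T R)
    (X : V -> {RV P >-> R}) : Prop :=
  mutually_independent X /\
  forall (u : V) (A : set R), measurable A ->
    distribution P (X u) A = uniform_prob (@ltr01 R) A.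

Definition nondegenerate_random_variable (d : measure_display)
    (T : measurableType d) (R : realType) (P : probability T R)
    (Y : T -> \bar R) : Prop :=
  measurable_fun setT Y /\
  ~ exists c : \bar R, {ae P, forall t, Y t = c}.

(* Main.v *)
(* Part 1. Moves act on the cumulative profile of a weight on the line by
   relaxing it at one point towards the mean of its neighbours. A final level
   at 0 is the mean of eta0 under a unimodal weight xi obtained from the unit
   mass at 0, and the relaxation picture gives xi z <= 1 / (|z| + 1). Hence, if
   among the n sites next to 0 on either side at most one in six have
   eta0 > 1 - tau, for every n, at least half of the mass of xi sits where
   eta0 <= 1 - tau, and kappa <= 1 - tau / 2. This has positive probability,
   whereas kappa >= eta0(v) exceeds every a < 1 with positive probability.

   Part 2. If G is not the line, some vertex has degree other than 2, and by
   quasi-transitivity such a vertex lies within distance L of every vertex.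
   Hence every window of 2 L + 1 sites of a geodesic from v has a neighbour
   ("hook") off the geodesic. Levelling x_0, .., x_k with a full hook at x_k
   multiplies the deficit on x_0, .., x_k by (k + 1) / (k + 2). Doing so for
   all full hooks, the farthest first, leaves a deficit with mean at most
   \prod_j (1 - p / (C j)), which tends to 0 as the harmonic series diverges. *)
Require Import Defs.
From mathcomp Require Import all_boot all_order all_algebra.
From mathcomp Require Import all_classical all_reals all_analysis.
From mathcomp Require Import measurable_realfun.
From mathcomp Require Import zify ring lra.

Set Implicit Arguments.
Unset Strict Implicit.
Unset Printing Implicit Defensive.

Import Order.TTheory GRing.Theory Num.Theory.

Local Open Scope classical_set_scope.
Local Open Scope ring_scope.

(** * Moves and levelling *)

Section Water.
Variables (V : choiceType) (E : rel V) (R : realType).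
Implicit Types (eta zeta : V -> R) (ms : seq (move V R)) (s : seq V).

Lemma convex_half_le (mu a b c : R) : 0 <= mu <= 2^-1 -> a <= c -> b <= c ->
  (1 - 2 * mu) * a + 2 * mu * b <= c.
Proof.
move=> /andP[mu0 mu1] ac bc.
have -> : c = (1 - 2 * mu) * c + 2 * mu * c by ring.
by apply: lerD; apply: ler_wpM2l => //; lra.
Qed.

Lemma convex_le (mu a b c : R) : 0 <= mu <= 2^-1 -> a <= c -> b <= c ->
  a + mu * (b - a) <= c.
Proof.
move=> mu01 ac bc; have := @convex_half_le (mu / 2) a b c.
have -> : (1 - 2 * (mu / 2)) * a + 2 * (mu / 2) * b = a + mu * (b - a) by field.
by apply => //; lra.
Qed.

Lemma water_run_cat eta ms1 ms2 :
  water_run eta (ms1 ++ ms2) = water_run (water_run eta ms1) ms2.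
Proof. exact: foldl_cat. Qed.

Lemma water_stepC (x y : V) mu eta : x != y ->
  water_step eta ((x, y), mu) = water_step eta ((y, x), mu).
Proof.
move=> xy; apply/funext => w /=.
case: (eqVneq w x) => [->|_]; last by [].
by rewrite (negPf xy).
Qed.

Lemma water_step_affine (a b : R) eta zeta m :
  water_step (fun u => a * eta u + b * zeta u) m =
  (fun u => a * water_step eta m u + b * water_step zeta m u).
Proof.
case: m => [[x y] mu]; apply/funext => w /=.
by case: ifP => _; [|case: ifP => _]; try ring.
Qed.

Lemma water_run_affine (a b : R) eta zeta ms w :
  water_run (fun u => a * eta u + b * zeta u) ms w =
  a * water_run eta ms w + b * water_run zeta ms w.
Proof.
elim: ms eta zeta => [//|m ms IH] eta zeta.
by rewrite /water_run /= water_step_affine [LHS]IH.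
Qed.

Lemma water_step_split (x y : V) mu eta :
  water_step eta ((x, y), mu) =
  (fun u => (1 - 2 * mu) * eta u + 2 * mu * water_step eta ((x, y), 2^-1) u).
Proof.
apply/funext => w /=.
case: (eqVneq w x) => [->|_]; first by field.
case: (eqVneq w y) => [->|_]; first by field.
ring.
Qed.

Lemma admissible_half (x y : V) : admissible E ((x, y), 2^-1 : R) = E x y.
Proof. by rewrite /admissible /= lexx andbT; case: (E x y) => //=; lra. Qed.

(* The final level is affine in each mu separately, so it is maximised at an
   endpoint: mu = 0 (drop the move) or mu = 1/2. *)
Lemma water_run_half eta ms v : all (@admissible V E R) ms ->
  exists2 es : seq (V * V), all (fun e => E e.1 e.2) es &
    water_run eta ms v <= water_run eta [seq (e, 2^-1) | e <- es] v.
Proof.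
elim: ms eta => [|m ms IH] eta; first by exists [::].
rewrite [all _ _]/= => /andP[/andP[Em m01] adm].
have -> : water_run eta (m :: ms) v = (1 - 2 * m.2) * water_run eta ms v
    + 2 * m.2 * water_run (water_step eta (m.1, 2^-1)) ms v.
  rewrite -water_run_affine; congr (water_run _ ms v).
  by case: m {Em m01} => [[x y] mu]; exact: water_step_split.
have [les|lts] := leP (water_run eta ms v)
    (water_run (water_step eta (m.1, 2^-1)) ms v).
- have [es esE le] := IH (water_step eta (m.1, 2^-1)) adm.
  exists (m.1 :: es); first by rewrite /= Em.
  apply: le_trans le; exact: convex_half_le.
- have [es esE le] := IH eta adm; exists es => //.
  apply: le_trans le; apply: convex_half_le => //; exact: ltW.
Qed.

Lemma water_step_le eta m c : admissible E m -> (forall u, eta u <= c) ->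
  forall u, water_step eta m u <= c.
Proof.
case: m => [[x y] mu] /andP[_ /= mu01] H w.
by case: ifP => _; [|case: ifP => _]; rewrite ?convex_le.
Qed.

Lemma water_run_le eta ms c : all (@admissible V E R) ms ->
  (forall u, eta u <= c) -> forall u, water_run eta ms u <= c.
Proof.
elim: ms eta => [//|m ms IH] eta /= /andP[am ams] H.
by apply: IH => //; exact: water_step_le.
Qed.

Lemma kappa_le eta v c : (forall u, eta u <= c) -> (kappa E eta v <= c%:E)%E.
Proof.
by move=> H; apply: ge_ereal_sup => _ [ms /= ams <-]; rewrite lee_fin;
  exact: water_run_le.
Qed.

Lemma kappa_ge_run eta v ms : all (@admissible V E R) ms ->
  ((water_run eta ms v)%:E <= kappa E eta v)%E.
Proof. by move=> ams; apply: ereal_sup_ubound; exists ms. Qed.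

Lemma kappa_ge_init eta v : ((eta v)%:E <= kappa E eta v)%E.
Proof. exact: (@kappa_ge_run eta v [::]). Qed.

Definition moves_within s ms :=
  all (fun m : move V R => (m.1.1 \in s) && (m.1.2 \in s)) ms.

Hypothesis Eirr : irreflexive E.

(** Two sums whose terms differ only at [x] and [y]. It yields conservation of mass, the energy loss
    of a half move, and the symmetry of a move. *)
Lemma big_swap2 (F G : V -> R) (x y : V) s : uniq s -> x \in s -> y \in s ->
  x != y -> (forall w, w != x -> w != y -> F w = G w) ->
  \sum_(u <- s) F u - \sum_(u <- s) G u = F x + F y - G x - G y.
Proof.
move=> us xs ys xy FG.
rewrite (bigD1_seq x) //= [X in _ - X](bigD1_seq x) //=.
have ysx : y \in rem x s by rewrite mem_rem_uniq // inE eq_sym xy.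
rewrite -big_filter -[X in _ - (_ + X)]big_filter -rem_filter //.
rewrite (bigD1_seq y) ?rem_uniq //= [X in _ - (_ + X)](bigD1_seq y) ?rem_uniq //=.
have -> : \sum_(i <- rem x s | i != y) F i = \sum_(i <- rem x s | i != y) G i.
  rewrite big_seq_cond [RHS]big_seq_cond; apply: eq_bigr => w /andP[+ wy].
  by rewrite mem_rem_uniq // inE => /andP[wx _]; exact: FG.
by move: (\sum_(_ <- _ | _) _) => S; ring.
Qed.

Lemma water_step_other eta (x y : V) mu w : w != x -> w != y ->
  water_step eta ((x, y), mu) w = eta w.
Proof. by move=> /= /negPf -> /negPf ->. Qed.

Lemma water_step_sum s eta m : uniq s -> admissible E m ->
  (m.1.1 \in s) && (m.1.2 \in s) ->
  \sum_(u <- s) water_step eta m u = \sum_(u <- s) eta u.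
Proof.
case: m => [[x y] mu] us /andP[/= Exy _] /andP[xs ys].
have xy : x != y by apply: contraTneq Exy => ->; rewrite Eirr.
apply/eqP; rewrite -subr_eq0; apply/eqP.
rewrite (@big_swap2 _ _ x y) //; last by move=> w; exact: water_step_other.
by rewrite /= !eqxx eq_sym (negPf xy); ring.
Qed.

Lemma water_run_sum s eta ms : uniq s -> all (@admissible V E R) ms ->
  moves_within s ms ->
  \sum_(u <- s) water_run eta ms u = \sum_(u <- s) eta u.
Proof.
move=> us; elim: ms eta => [//|m ms IH] eta /= /andP[am ams] /andP[wm wms].
by rewrite IH // water_step_sum.
Qed.

Lemma water_run_outside s eta ms w : moves_within s ms -> w \notin s ->
  water_run eta ms w = eta w.
Proof.
move=> + ws; elim: ms eta => [//|[[x y] mu] ms IH] eta /= /andP[/andP[xs ys] wms].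
rewrite [LHS]IH //; apply: water_step_other.
  by apply: contraNneq ws => ->.
by apply: contraNneq ws => ->.
Qed.

Lemma half_step_energy s eta (x y : V) : uniq s -> x \in s -> y \in s -> x != y ->
  \sum_(u <- s) water_step eta ((x, y), 2^-1) u ^+ 2 -
  \sum_(u <- s) eta u ^+ 2 = - ((eta x - eta y) ^+ 2 / 2).
Proof.
move=> us xs ys xy; rewrite (@big_swap2 _ _ x y) //; last first.
  by move=> w wx wy; rewrite water_step_other.
by rewrite /= !eqxx eq_sym (negPf xy); field.
Qed.

(* Minimise the energy \sum eta ^ 2 over the reachable profiles: near the
   infimum, a half move along an edge of the path can gain almost nothing, so
   neighbouring levels almost agree. *)
Lemma level_neighbours y q eta delta : path E y q -> uniq (y :: q) -> 0 < delta ->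
  exists ms, [/\ all (@admissible V E R) ms, moves_within (y :: q) ms &
    forall a b, a \in y :: q -> b \in y :: q -> E a b ->
      `|water_run eta ms a - water_run eta ms b| <= delta].
Proof.
move=> pq uq d0.
pose ok ms := all (@admissible V E R) ms && moves_within (y :: q) ms.
pose en ms := \sum_(u <- y :: q) water_run eta ms u ^+ 2.
pose S := [set en ms | ms in [set ms | ok ms]].
have S0 : lbound S 0.
  by move=> _ [ms _ <-]; apply: sumr_ge0 => u _; exact: sqr_ge0.
have hS : has_inf S by split; [exists (en [::]); exists [::]|exists 0].
(* [delta ^+ 2 / 2] is what a half move gains across a gap of [delta]; a larger gap would lead below
   the infimum. *)
have [|_ [ms /= /andP[am wm] <-] lt] := inf_adherent (eps := delta ^+ 2 / 2) _ hS.
  by rewrite divr_gt0 // exprn_gt0.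
exists ms; split => // a b ain bin Eab.
have ab : a != b by apply: contraTneq Eab => ->; rewrite Eirr.
have : inf S <= en (rcons ms ((a, b), 2^-1)).
  apply: ge_inf; first by exists 0.
  exists (rcons ms ((a, b), 2^-1)) => //=; rewrite /ok /moves_within !all_rcons.
  rewrite -/(moves_within _ _).
  by rewrite am wm /= ain bin admissible_half Eab.
have -> : en (rcons ms ((a, b), 2^-1)) =
    \sum_(u <- y :: q) water_step (water_run eta ms) ((a, b), 2^-1) u ^+ 2.
  by rewrite /en -cats1 water_run_cat.
have := half_step_energy (water_run eta ms) uq ain bin ab.
rewrite -/(en ms); set r := _ ^+ 2 / 2.
move: lt; move: (\sum_(u <- y :: q) _) (en ms) (inf S) => A B C lt H1 H2.
have {H1 H2 lt} : r <= delta ^+ 2 / 2 by lra.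
by rewrite /r ler_pM2r // => H; rewrite -(ger0_norm (ltW d0)) -ler_sqr ?nnegrE // !real_normK ?num_real.
Qed.

Lemma path_close (f : V -> R) y q delta :
  (forall a b, a \in y :: q -> b \in y :: q -> E a b -> `|f a - f b| <= delta) ->
  path E y q -> forall a, a \in y :: q -> `|f y - f a| <= (size q)%:R * delta.
Proof.
elim: q y => [|z q IH] y H /= => [_ a|/andP[yz pq] a].
  by rewrite inE => /eqP ->; rewrite subrr normr0 mul0r.
have d0 : 0 <= delta.
  by apply: le_trans (H y z _ _ yz); rewrite ?normr_ge0 // !inE eqxx ?orbT.
rewrite inE => /predU1P[->|az].
  by rewrite subrr normr0 mulr_ge0.
have -> : f y - f a = (f y - f z) + (f z - f a) by ring.
apply: le_trans (ler_normD _ _) _; rewrite -natr1 mulrDl mul1r addrC.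
apply: lerD; last by apply: H => //; rewrite !inE eqxx ?orbT.
apply: IH => // b c bq cq; apply: H; by rewrite inE ?bq ?cq orbT.
Qed.

(** The mass on the path is conserved and its levels can be made nearly equal, so each of them comes
    close to the mean, which exceeds [c]. The inequality is strict because exact equality is in
    general reached only in the limit. *)
Lemma level_path y q eta c : path E y q -> uniq (y :: q) ->
  c * (size q).+1%:R < \sum_(x <- y :: q) eta x ->
  exists ms, [/\ all (@admissible V E R) ms, moves_within (y :: q) ms &
    forall a, a \in y :: q -> c <= water_run eta ms a].
Proof.
move=> pq uq lt.
set S := \sum_(x <- y :: q) eta x in lt.
set n := (size q).+1%:R in lt.
have n0 : 0 < n by rewrite /n ltr0n.
(* With this [d] two levels differ by at most [S / n - c], so one level below [c] keeps all others
   at or below the mean and the sum is too small. *)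
pose d := (S / n - c) / (2 * n).
have cS : c < S / n by rewrite ltr_pdivlMr.
have d0 : 0 < d by rewrite divr_gt0 ?subr_gt0 ?mulr_gt0.
have [ms [am wm H]] := level_neighbours eta pq uq d0.
exists ms; split => // a aq; rewrite leNgt; apply/negP => lta.
have : \sum_(x <- y :: q) water_run eta ms x = S by rewrite water_run_sum.
have close := path_close H pq.
have ub x : x \in y :: q -> water_run eta ms x <= S / n.
  move=> xq; have := close x xq; have := close a aq.
  rewrite !ler_norml => /andP[h1 h2] /andP[h3 h4].
  have : 2 * ((size q)%:R * d) <= S / n - c.
    have -> : S / n - c = 2 * (n * d) by rewrite /d; field; rewrite gt_eqF.
    by rewrite ler_pM2l // ler_wpM2r ?(ltW d0) // ler_nat.
  move: h1 h2 h3 h4 lta; move: (_%:R * d) (S / n) (water_run _ _ _).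
  move: (water_run _ _ _) (water_run _ _ _) => f1 f2 kd m f3; lra.
move=> eqS; have : \sum_(x <- y :: q) water_run eta ms x < \sum_(x <- y :: q) (S / n).
  rewrite (bigD1_seq a) //= [ltRHS](bigD1_seq a) //=.
  apply: ltr_leD; first exact: lt_trans lta cS.
  rewrite big_seq_cond [leRHS]big_seq_cond.
  by apply: ler_sum => x /andP[xq _]; exact: ub.
rewrite eqS big_const_seq count_predT iter_addr addr0.
by rewrite -mulr_natr [X in _ * X]/= -/n divfK ?gt_eqF // ltxx.
Qed.

End Water.

(** * Hooks along geodesics *)

Section Graph.
Variables (V : choiceType) (E : rel V).
Implicit Types (u v w : V) (p q r : seq V).

Definition degree_two u :=
  exists a b, a != b /\ forall w, E u w = (w == a) || (w == b).

Lemma automorphism_path f u q : graph_automorphism E f -> path E u q ->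
  path E (f u) (map f q).
Proof.
move=> [_ Ef]; elim: q u => //= w q IH u /andP[uw wq].
by rewrite Ef uw IH.
Qed.

Lemma automorphism_degree_two f u : graph_automorphism E f ->
  degree_two (f u) -> degree_two u.
Proof.
move=> [[g fK gK] Ef] [a [b [ab H]]].
exists (g a), (g b); split.
  by apply: contraNneq ab => /(congr1 f); rewrite !gK => ->.
by move=> w; rewrite -Ef H !(can2_eq fK gK).
Qed.

(** Each nonempty class has a member with a walk to [w0], and automorphisms carry this walk to every
    other member. They preserve degree two, so the image of [w0] is again a defect; [L] is the
    largest length over the finitely many classes. *)
Lemma defect_nearby w0 : graph_connected E -> quasi_transitive E ->
  ~ degree_two w0 ->
  exists L, forall u, exists q,
    [/\ path E u q, (size q <= L)%N & ~ degree_two (last u q)].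
Proof.
move=> Ec [n [c aut]] w0d.
have H i : exists l, forall u, c u = i -> exists q,
    [/\ path E u q, (size q <= l)%N & ~ degree_two (last u q)].
  have [[y yi]|no] := pselect (exists y, c y = i); last first.
    by exists 0%N => u ui; exfalso; apply: no; exists u.
  have [p [yp pw]] := Ec y w0.
  exists (size p) => u ui; have [f [fa fy]] := aut y u (etrans yi (esym ui)).
  exists (map f p); split; rewrite ?size_map //.
    by rewrite -fy; apply: automorphism_path.
  by rewrite -fy last_map pw => /(automorphism_degree_two fa).
have [l lP] := choice H.
exists (\max_(i < n) l i) => u; have [q [uq ql qd]] := lP (c u) u erefl.
by exists q; split => //; apply: leq_trans ql _; apply: leq_bigmax.
Qed.

Definition ball v N :=
  [set w | exists q, [/\ path E v q, last v q = w & (size q <= N)%N]].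

Hypothesis Edeg : bounded_degree E.

Lemma neighbours_finite u : finite_set [set w | E u w].
Proof. by have [D H] := Edeg; apply: card_le_finite (H u) (finite_II D). Qed.

Lemma ball_finite v N : finite_set (ball v N).
Proof.
elim: N => [|N IH].
  apply: (@sub_finite_set _ _ [set v]) (finite_set1 v).
  by move=> w [q [_ + +]]; case: q => //= ->.
apply: (@sub_finite_set _ _ (ball v N `|` \bigcup_(u in ball v N) [set w | E u w])).
  move=> w [q]; case/lastP: q => [[_ <- _]|q z]; first by left; exists [::].
  rewrite rcons_path last_rcons size_rcons ltnS => -[/andP[vq qz] <- qN].
  by right; exists (last v q) => //; exists q.
by rewrite finite_setU; split => //; apply: bigcup_finite => // u _;
  exact: neighbours_finite.
Qed.

Lemma vertices_countable v : graph_connected E -> countable [set: V].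
Proof.
move=> Ec; have -> : [set: V] = \bigcup_N ball v N.
  apply/esym; rewrite -subTset => w _; have [p [vp pw]] := Ec v w.
  by exists (size p) => //; exists p.
by apply: bigcup_countable => // N _; apply/finite_set_countable/ball_finite.
Qed.

Lemma last_take_nth v p k : (k <= size p)%N ->
  last v (take k p) = nth v (v :: p) k.
Proof.
elim: p v k => [|x p IH] v [|k] //= kp.
by rewrite IH //; case: k kp => //= k kp; apply: set_nth_default.
Qed.

Definition geodesic v p := path E v p /\
  forall q, path E v q -> last v q = last v p -> (size p <= size q)%N.

(** Balls are finite, so some [w] lies outside the ball of radius [N]; a shortest walk from [v] to
    [w] is the geodesic. *)
Lemma geodesic_exists v N : graph_connected E -> infinite_set [set: V] ->
  exists2 p, geodesic v p & (N <= size p)%N.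
Proof.
move=> Ec Vinf.
have [w wN] : exists w, ~ ball v N w.
  apply: contrapT => no; apply: Vinf.
  apply: (@sub_finite_set _ _ (ball v N)) (ball_finite v N) => w _.
  by apply: contrapT => nw; apply: no; exists w.
pose P n := `[< exists q, [/\ path E v q, last v q = w & size q = n] >].
have exP : exists n, P n.
  by have [p [vp pw]] := Ec v w; exists (size p); apply/asboolP; exists p.
case: (ex_minnP exP) => m /asboolP[p [vp pw pm]] min; exists p.
  split=> // q vq qw; rewrite pm; apply: min; apply/asboolP; exists q.
  by split => //; rewrite qw.
rewrite leqNgt; apply/negP => pN; apply: wN; exists p; split => //.
exact: ltnW.
Qed.

(** * Neighbours of a geodesic and walks along it *)

Section Geodesic.
Variables (v : V) (p : seq V).
Hypotheses (Esym : symmetric E) (Eirr : irreflexive E) (gp : geodesic v p).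
Local Notation x := (nth v (v :: p)).

(** Replacing the stretch from [x i] to [x j] by [r] gives a walk with the same ends, which by
    minimality is not shorter. *)
Lemma geodesic_shortcut i j r : (i <= j <= size p)%N -> path E (x i) r ->
  last (x i) r = x j -> (j <= i + size r)%N.
Proof.
case: gp => vp min /andP[ij jp] pr rj.
have ip := leq_trans ij jp.
have lastj : last (x j) (drop j p) = last v p.
  by rewrite -(last_take_nth _ jp) -last_cat cat_take_drop.
have := min (take i p ++ r ++ drop j p).
rewrite !cat_path take_path // !last_cat !last_take_nth // pr rj lastj.
have -> : path E (x j) (drop j p).
  by move: vp; rewrite -{1}(cat_take_drop j p) cat_path last_take_nth // => /andP[].
move=> /(_ isT erefl); rewrite !size_cat size_drop size_takel //.
lia.
Qed.

Lemma geodesic_inj i j : (i <= size p)%N -> (j <= size p)%N -> x i = x j -> i = j.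
Proof.
wlog ij : i j / (i <= j)%N.
  move=> H ip jp e; have [ij|/ltnW ji] := leqP i j; first exact: H.
  by apply/esym; apply: H.
move=> ip jp e; have := @geodesic_shortcut i j [::]; rewrite ij jp /=.
move=> /(_ isT isT e); lia.
Qed.

Lemma geodesic_uniq : uniq (v :: p).
Proof.
apply/(uniqP v) => i j; rewrite !inE /= !ltnS; exact: geodesic_inj.
Qed.

Lemma geodesic_adj i j : (i <= size p)%N -> (j <= size p)%N -> E (x i) (x j) ->
  (j <= i.+1)%N.
Proof.
move=> ip jp Eij; have [ji|/ltnW ij] := leqP j i; first by rewrite ltnW.
have := @geodesic_shortcut i j [:: x j]; rewrite ij jp /= Eij.
by move=> /(_ isT isT erefl); rewrite addn1.
Qed.

Lemma geodesic_step i : (i < size p)%N -> E (x i) (x i.+1).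
Proof. by case: gp => vp _ ip; move/(pathP v): vp => /(_ i ip). Qed.

Definition unhooked i :=
  (0 < i < size p)%N /\ forall u, E (x i) u -> u \in v :: p.

Lemma unhooked_neighbour i z : unhooked i -> E (x i) z ->
  z = x i.-1 \/ z = x i.+1.
Proof.
move=> [/andP[i0 ip] inp] Ez; have zp := inp z Ez.
move: zp Ez => /(nthP v)[j]; rewrite /= ltnS => jp <- Ej.
have h1 := geodesic_adj (ltnW ip) jp Ej.
have h2 : (i <= j.+1)%N by apply: geodesic_adj; rewrite // ?(ltnW ip) // Esym.
have ij : j = i.-1 \/ j = i.+1 \/ j = i by lia.
by case: ij Ej => [->|[->|->]] Ej; [left|right|rewrite Eirr in Ej].
Qed.

Lemma unhooked_degree_two i : unhooked i -> degree_two (x i).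
Proof.
move=> ui; have [/andP[i0 ip] _] := ui.
exists (x i.-1), (x i.+1); split.
  by apply/eqP => /geodesic_inj e; have : i.-1 = i.+1 by [apply: e; lia]; lia.
move=> w; apply/idP/orP => [/(unhooked_neighbour ui)[]->|[]/eqP->].
- by left.
- by right.
- by rewrite Esym; have := @geodesic_step i.-1; rewrite prednK //; apply; lia.
- exact: geodesic_step.
Qed.

(** The only neighbours of an unhooked vertex are the two next to it on the geodesic, so each step
    of the walk shifts the position by one. *)
Lemma unhooked_walk q i : path E (x i) q ->
  (forall j, (i <= j + size q)%N -> (j <= i + size q)%N -> unhooked j) ->
  exists j, [/\ (i <= j + size q)%N, (j <= i + size q)%N & last (x i) q = x j].
Proof.
elim: q i => [|z q IH] i /=; first by exists i; rewrite addn0.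
move=> /andP[Ez zq] un.
have [j ij zj] : exists2 j, j = i.-1 \/ j = i.+1 & z = x j.
  have ui : unhooked i by apply: un; lia.
  have [->|->] := unhooked_neighbour ui Ez.
    by exists i.-1 => //; left.
  by exists i.+1 => //; right.
move: zq; rewrite zj => zq.
have [|k [h1 h2 ->]] := IH j zq.
  by move=> k h1 h2; apply: un; lia.
by exists k; split => //; lia.
Qed.

(** Otherwise the whole window is unhooked; the walk of length at most [L] to a defect stays in it
    and ends at a vertex of degree two. *)
Lemma hook_in_window L i :
  (forall u, exists q, [/\ path E u q, (size q <= L)%N & ~ degree_two (last u q)]) ->
  (L < i)%N -> (i + L < size p)%N ->
  exists k u, [/\ (i <= k + L)%N, (k <= i + L)%N, u \notin v :: p & E (x k) u].
Proof.
move=> def Li ip; apply: contrapT => no.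
have un j : (i <= j + L)%N -> (j <= i + L)%N -> unhooked j.
  move=> h1 h2; split; first lia.
  by move=> u Eu; apply: contrapT => /negP up; apply: no; exists j, u.
have [q [xq qL]] := def (x i); apply.
have [|j [h1 h2 ->]] := unhooked_walk xq.
  by move=> j h1 h2; apply: un; lia.
by apply: unhooked_degree_two; apply: un; lia.
Qed.

End Geodesic.

(** One hook is taken from each of [J] disjoint windows. [C] is independent of [J], so the positions
    grow at most linearly in [j] and their reciprocals have a divergent sum. *)
Lemma hooks_exist w0 : symmetric E -> irreflexive E ->
  infinite_set [set: V] -> graph_connected E ->
  quasi_transitive E -> ~ degree_two w0 ->
  exists2 C, (0 < C)%N & forall v J, exists p (k : nat -> nat) (u : nat -> V),
    [/\ path E v p, uniq (v :: p),
      forall j, (j < J)%N -> (k j).+2 <= j.+1 * C,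
      forall j, (j < J)%N -> [/\ (k j <= size p)%N, u j \notin v :: p &
        E (nth v (v :: p) (k j)) (u j)] &
      forall i j, (i < j < J)%N -> (k i < k j)%N /\ u i != u j]%N.
Proof.
move=> Esym Eirr Vinf Ec Eq w0d.
have [L def] := defect_nearby Ec Eq w0d.
(* Window [j] has centre [L.+1 + j * C] and radius [L]. This [C] makes the bound on [(k j).+2] exact
   at the far end of the window and keeps positions of different windows at least 3 apart, too far
   for a common hook. *)
exists (2 * L + 3)%N => [|v J]; first by rewrite addn3.
set C := (2 * L + 3)%N.
have [p gp szp] := geodesic_exists v (J * C) Ec Vinf.
have H j : exists ku : nat * V, (j < J)%N ->
    [/\ (L.+1 + j * C <= ku.1 + L)%N, (ku.1 <= L.+1 + j * C + L)%N,
      ku.2 \notin v :: p & E (nth v (v :: p) ku.1) ku.2].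
  have [jJ|] := ltnP j J; last by exists (0%N, v).
  have jC : (j.+1 * C <= J * C)%N by rewrite leq_mul2r jJ orbT.
  have [||k [u [h1 h2 h3 h4]]] := @hook_in_window v p Esym Eirr gp L (L.+1 + j * C) def.
  - lia.
  - by move: jC; rewrite mulSn; rewrite /C in szp *; lia.
  - by exists (k, u).
have [ku kuP] := choice H.
have mono i j : (i < j)%N -> (i * C + C <= j * C)%N.
  by move=> ij; rewrite -mulSnr leq_mul2r ij orbT.
exists p, (fun j => (ku j).1), (fun j => (ku j).2); split.
- by case: gp.
- exact: geodesic_uniq gp.
- by move=> j /kuP[_ h _ _]; rewrite mulSn /C in h *; lia.
- move=> j jJ; have [h1 h2 h3 h4] := kuP j jJ; split => //.
  by have := mono j J jJ; rewrite /C in h1 h2 szp *; lia.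
move=> i j /andP[ij jJ]; have m := mono i j ij.
have [h1 h2 h3 h4] := kuP i (ltn_trans ij jJ).
have [h1' h2' h3' h4'] := kuP j jJ.
have jC := mono j J jJ.
split; first by rewrite /C in m h1 h2 h1' h2' *; lia.
apply/eqP => eu.
(* a common neighbour would shortcut the geodesic *)
have := @geodesic_shortcut v p gp (ku i).1 (ku j).1 [:: (ku i).2; nth v (v :: p) (ku j).1].
rewrite /= h4 eu Esym h4' /= => S; have {}S := S _ isT erefl.
have : ((ku j).1 <= (ku i).1 + 2)%N.
  by apply: S; rewrite /C in m h1 h2 h1' h2' jC szp; lia.
by rewrite /C in m h1 h2 h1' h2'; lia.
Qed.

End Graph.

(** * Levelling with the hooks of a path *)

Section Hooks.
Variables (V : choiceType) (E : rel V) (R : realType).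
Hypothesis Eirr : irreflexive E.

Definition hook_factor (a : R) (eta : V -> R) (k : nat) (u : V) : R :=
  if a < eta u then k.+1%:R / k.+2%:R else 1.

Lemma ler_sum_const (eta : V -> R) c s :
  (forall x, x \in s -> c <= eta x) -> c * (size s)%:R <= \sum_(x <- s) eta x.
Proof.
elim: s => [|x s IH] H; first by rewrite big_nil mulr0.
rewrite big_cons /= -natr1 mulrDr mulr1 addrC lerD //.
  by apply: H; rewrite inE eqxx.
by apply: IH => y ys; apply: H; rewrite inE ys orbT.
Qed.

(* The far hooks are used first: levelling x_0, .., x_k with a hook holding
   more than a multiplies the deficit a - c by at most (k + 1) / (k + 2). *)
Lemma hooked_path v p J (k : nat -> nat) (u : nat -> V) (a c : R) zeta :
  path E v p -> uniq (v :: p) ->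
  (forall j, (j < J)%N -> [/\ (k j <= size p)%N, u j \notin v :: p &
     E (nth v (v :: p) (k j)) (u j)]) ->
  (forall i j, (i < j < J)%N -> (k i < k j)%N /\ u i != u j) ->
  c <= zeta v ->
  (forall i j, (j < J)%N -> (i <= k j)%N -> c <= zeta (nth v (v :: p) i)) ->
  exists2 ms, all (@admissible V E R) ms &
    a - (a - c) * \prod_(j < J) hook_factor a zeta (k j) (u j) <=
    water_run zeta ms v.
Proof.
move=> pp up; elim: J c zeta => [|J IH] c zeta hk inj cv cp.
  by exists [::] => //=; rewrite big_ord0 mulr1 opprB addrCA subrr addr0.
have hk' j : (j < J)%N -> [/\ (k j <= size p)%N, u j \notin v :: p &
     E (nth v (v :: p) (k j)) (u j)] by move=> jJ; apply: hk; exact: ltnW.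
have inj' i j : (i < j < J)%N -> (k i < k j)%N /\ u i != u j.
  by move=> /andP[ij jJ]; apply: inj; rewrite ij ltnW.
rewrite big_ord_recr /=.
have [le|lt] := leP (zeta (u J)) a.
  rewrite {2}/hook_factor ltNge le /= mulr1.
  apply: IH => // i j jJ; apply: cp; exact: ltnW.
have [kJ uJ EJ] := hk J (ltnSn J).
set K := k J in kJ EJ *.
pose q := rcons (take K p) (u J).
have tsub : {subset v :: take K p <= v :: p}.
  move=> x; rewrite !inE => /orP[->//|/mem_take ->]; exact: orbT.
have pq : path E v q.
  by rewrite rcons_path last_take_nth // EJ take_path.
have uq : uniq (v :: q).
  rewrite -rcons_cons rcons_uniq (contra (tsub _) uJ) /=.
  have := up => /= /andP[vp upp]; rewrite take_uniq // andbT.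
  by apply: contra vp => /mem_take.
have szq : size q = K.+1 by rewrite size_rcons size_takel.
(* The mean guaranteed by [K.+1] levels of at least [c] and a hook above [a]:
   [c' * K.+2%:R = c * K.+1%:R + a]. *)
pose c' := a - (a - c) * (K.+1%:R / K.+2%:R).
have n0 : (0 : R) < K.+2%:R by rewrite ltr0n.
have [|ms [am wm H]] := @level_path V E R Eirr v q zeta c' pq uq.
  rewrite szq -rcons_cons -cats1 big_cat big_seq1 /=.
  have : c * K.+1%:R <= \sum_(x <- v :: take K p) zeta x.
    have := @ler_sum_const zeta c (v :: take K p); rewrite /= size_takel //.
    apply => x /(nthP v)[i]; rewrite [size _]/= size_takel // => iK <-.
    have -> : nth v (v :: take K p) i = nth v (v :: p) i.
      by case: i iK => //= i iK; rewrite nth_take.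
    exact: (cp i J).
  have -> : c' * K.+2%:R = c * K.+1%:R + a.
    move: n0; rewrite /c' -[K.+2%:R]natr1; move: (K.+1%:R) => m m0.
    by field; rewrite gt_eqF.
  by move=> S; apply: ler_ltD.
(* The remaining hooks lie off the levelled path, so their levels and factors are unchanged. *)
have qout j : (j < J)%N -> u j \notin v :: q.
  move=> jJ; rewrite -rcons_cons mem_rcons inE negb_or.
  have [_ -> /=] := inj j J ltac:(by rewrite jJ /=).
  by have [_ + _] := hk' j jJ; apply: contra => /tsub.
have [||ms' am' le] := IH c' (water_run zeta ms) hk' inj'.
- by apply: H; rewrite inE eqxx.
- move=> i j jJ ij; apply: H.
  have iK : (i < K.+1)%N.
    have [ltk _] := inj j J ltac:(by rewrite jJ /=).
    by rewrite ltnS (leq_trans ij) // ltnW.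
  have -> : nth v (v :: p) i = nth v (v :: take K p) i.
    by case: i iK {ij} => //= i iK; rewrite nth_take.
  by rewrite -rcons_cons mem_rcons inE mem_nth ?orbT //= size_takel.
exists (ms ++ ms'); first by rewrite all_cat am.
rewrite water_run_cat; apply: le_trans le.
rewrite (_ : \prod_(j < J) hook_factor a (water_run zeta ms) (k j) (u j) =
  \prod_(j < J) hook_factor a zeta (k j) (u j)); last first.
  apply: eq_bigr => j _; rewrite /hook_factor (@water_run_outside _ _ (v :: q)) //.
  exact: qout.
rewrite {2}/hook_factor lt /c'.
by move: (\prod_(_ < _) _) (_ / _) => P f; rewrite le_eqVlt; apply/orP; left; apply/eqP; ring.
Qed.

End Hooks.

(** * Recognising the line *)

Section Line.
Variables (V : choiceType) (E : rel V).
Hypotheses (Esym : symmetric E) (Eirr : irreflexive E).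
Hypotheses (Vinf : infinite_set [set: V]) (Ec : graph_connected E).

(** * Two-sided walks without backtracking *)

Section Walk.
Variable f : int -> V.
Hypotheses (fE : forall z, E (f z) (f (z + 1))) (fnb : forall z, f (z + 2) != f z).
Hypothesis fN : forall z w, E (f (z + 1)) w -> w = f z \/ w = f (z + 2).

Lemma line_walk_nbr z w : E (f z) w -> w = f (z - 1) \/ w = f (z + 1).
Proof.
have := @fN (z - 1) w; rewrite subrK => H /H.
by have -> : z - 1 + 2 = z + 1 by lia.
Qed.

Lemma line_walk_surj w : exists z, f z = w.
Proof.
have [q []] := Ec (f 0) w.
elim: q 0 => [|y q IH] z /=; first by exists z.
by move=> /andP[/line_walk_nbr[]->]; apply: IH.
Qed.

(* A closed walk of minimal length would be a finite component. *)
Lemma line_walk_injS n z : f z <> f (z + n.+1%:Z).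
Proof.
elim/ltn_ind: n z => n IH z e.
case: n IH e => [|[|n]] IH e.
- by have := fE z; rewrite {1}e Eirr.
- by have := fnb z; rewrite e eqxx.
(* The return closes up on the other side too: if the neighbour [f (z + n.+2%:Z)] of [f z] were
   [f (z + 1)], there would be a closed walk of [n.+1] steps. *)
have fz1 : f (z - 1) = f (z + n.+2%:Z).
  have : E (f z) (f (z + n.+2%:Z)).
    rewrite e Esym; have := fE (z + n.+2%:Z).
    by have -> : z + n.+2%:Z + 1 = z + n.+3%:Z by lia.
  move=> /line_walk_nbr[//|e1]; exfalso.
  apply: (IH n _ (z + 1)); first by [].
  by rewrite -e1; congr f; lia.
pose S := f @` [set z + i%:Z | i in `I_n.+3].
have Sin i : (i < n.+3)%N -> S (f (z + i%:Z)).
  by move=> ni; exists (z + i%:Z) => //; exists i.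
have Scl w w' : S w -> E w w' -> S w'.
  move=> [_ [i /= ni <-] <-] /line_walk_nbr[]->.
    case: i ni => [|i] ni.
      by rewrite addr0 fz1; apply: Sin.
    have -> : z + i.+1%:Z - 1 = z + i%:Z by lia.
    by apply: Sin; apply: ltnW.
  have -> : z + i%:Z + 1 = z + i.+1%:Z by lia.
  have [i1|] := ltnP i.+1 n.+3; first exact: Sin.
  move=> ni1; have -> : i.+1 = n.+3 by lia.
  by rewrite -e -[z]addr0; apply: (Sin 0%N).
apply: Vinf; apply: (@sub_finite_set _ _ S).
  move=> w _; have [q [zq <-]] := Ec (f z) w.
  have : S (f z) by have := Sin 0%N; rewrite addr0; apply.
  elim: q (f z) zq => [|y q IHq] x //= /andP[xy yq] Sx.
  by apply: IHq => //; apply: Scl xy.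
by do 2!apply: finite_image; exact: finite_II.
Qed.

Lemma line_walk_inj : injective f.
Proof.
have H z w : (z < w)%R -> f z <> f w.
  move=> zw; have -> : w = z + `|w - z|.-1.+1%:Z by lia.
  exact: line_walk_injS.
move=> z w e; have [zw|wz|//] := ltgtP z w.
  by case: (H _ _ zw).
by case: (H _ _ wz).
Qed.

Lemma line_walk_iso : graph_isomorphic line_graph E.
Proof.
exists f; split.
  have [g gP] := choice line_walk_surj.
  by exists g => // z; apply: line_walk_inj; rewrite gP.
move=> u w; apply/idP/idP.
  move=> /line_walk_nbr[]/line_walk_inj ->; rewrite /line_graph.
    by rewrite subrK eqxx orbT.
  by rewrite eqxx.
by move=> /orP[]/eqP->; rewrite // Esym.
Qed.

End Walk.

(** A walk that leaves each vertex by the other of its two edges, continued in both directions,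
    never backtracks. Following oriented edges makes the continuation a function of the current
    state. *)
Lemma degree_two_line (v : V) : (forall u, degree_two E u) ->
  graph_isomorphic line_graph E.
Proof.
move=> H2.
(* The other neighbour of [d.2] when coming from [d.1]; the value is arbitrary if these are not
   adjacent. *)
have Ho (d : V * V) : exists c, E d.2 d.1 ->
    [/\ E d.2 c, c != d.1 & forall w, E d.2 w -> w = d.1 \/ w = c].
  case: d => x y /=; have [a [b [ab H]]] := H2 y.
  exists (if x == a then b else a); rewrite H.
  case: (eqVneq x a) => [->|xa] /=; rewrite ?(negPf xa) /=.
    move=> _; rewrite H eqxx orbT eq_sym ab; split => // w.
    by rewrite H => /orP[]/eqP ->; [left|right].
  move=> /eqP ->; rewrite H eqxx; split => // w.
  by rewrite H => /orP[]/eqP ->; [right|left].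
have [oth othP] := choice Ho.
pose step d := (d.2, oth d).
pose back (d : V * V) := (oth (d.2, d.1), d.1).
pose dart (d : V * V) := E d.1 d.2.
have stepE d : dart d -> dart (step d).
  by move=> dd; have [] := othP d; rewrite // Esym.
have backE d : dart d -> dart (back d).
  by move=> dd; have [h _ _] := othP (d.2, d.1) dd; rewrite /dart /= Esym.
have stepK d : dart d -> step (back d) = d.
  move=> dd; rewrite /step /= [RHS]surjective_pairing; congr pair.
  have [h1 h2 h3] := othP (d.2, d.1) dd.
  have [h4 h5 h6] := othP (back d) h1.
  have [//|e] := h3 _ h4.
  by move: h5; rewrite e eqxx.
have [a [b [_ Ha]]] := H2 v.
have va : E v a by rewrite Ha eqxx.
pose D z := match z with Posz n => iter n step (v, a)
                       | Negz n => iter n.+1 back (v, a) end.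
have Dd z : dart (D z).
  by case: z => n; [elim: n => //= n; exact: stepE|
    rewrite /D; elim: n.+1 => //= m; exact: backE].
have DS z : D (z + 1) = step (D z).
  case: z => [n|[|n]].
  - by rewrite -PoszD addn1.
  - by rewrite NegzE addNr /= stepK.
  - have -> : Negz n.+1 + 1 = Negz n by lia.
    by rewrite [D (Negz n.+1)]/= [RHS]stepK //; exact: (Dd (Negz n)).
have DS2 z : (D (z + 2)).1 = oth (D z).
  by rewrite (_ : z + 2 = z + 1 + 1) ?DS //; lia.
apply: (@line_walk_iso (fun z => (D z).1)).
- by move=> z; rewrite DS; exact: Dd.
- by move=> z; rewrite DS2; have [] := othP (D z); rewrite // Esym; exact: Dd.
- move=> z w; rewrite DS2 DS /=; have Ez : E (D z).2 (D z).1 by rewrite Esym; exact: Dd.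
  by have [_ _] := othP _ Ez; apply.
Qed.

End Line.

(** * Independent uniform levels *)

Lemma uniform_prob01E (R : realType) (A : set R) : measurable A ->
  uniform_prob (@ltr01 R) A = lebesgue_measure (A `&` `[0, 1]).
Proof.
move=> mA; rewrite /uniform_prob integral_uniform_pdf.
rewrite (eq_integral (cst 1%E)); last first.
  move=> x /[!inE] -[_ /=]; rewrite in_itv /= => x01.
  by rewrite /uniform_pdf x01 subr0 invr1.
by rewrite integral_cst ?mul1e //; exact: measurableI.
Qed.

Section Probability.
Variables (V : choiceType) (d : measure_display) (T : measurableType d).
Variables (R : realType) (P : probability T R) (X : V -> {RV P >-> R}).
Implicit Types (A B : set T) (s : seq V) (q : V -> R).

Definition pr A : R := fine (P A).

Lemma prE A : measurable A -> P A = (pr A)%:E.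
Proof. by move=> mA; rewrite /pr fineK // fin_num_measure. Qed.

Lemma pr_ge0 A : 0 <= pr A. Proof. exact/fine_ge0/measure_ge0. Qed.

Lemma pr_le A B : measurable A -> measurable B -> A `<=` B -> pr A <= pr B.
Proof.
by move=> mA mB AB; rewrite -lee_fin -!prE //; apply: le_measure => //; rewrite inE.
Qed.

Lemma prU A B : measurable A -> measurable B -> pr (A `|` B) <= pr A + pr B.
Proof.
move=> mA mB; rewrite -lee_fin EFinD -!prE //; last exact: measurableU.
by apply: measureU2.
Qed.

Lemma prC A : measurable A -> pr (~` A) = 1 - pr A.
Proof.
move=> mA; apply: EFin_inj; rewrite EFinB -!prE //; last exact: measurableC.
exact: probability_setC.
Qed.

Section Independence.
Hypothesis Xind : mutually_independent X.

Lemma mX u (S : set R) : measurable S -> measurable (X u @^-1` S).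
Proof. by move=> mS; rewrite -[_ @^-1` _]setTI; exact: measurable_funP. Qed.

Definition cylinder s (S : V -> set R) := \bigcap_(u in [set` s]) (X u @^-1` S u).

Lemma measurable_cylinder s S : (forall u, measurable (S u)) ->
  measurable (cylinder s S).
Proof.
move=> mS; apply: fin_bigcap_measurable; first exact: finite_seq.
by move=> u _; exact: mX.
Qed.

Definition upd (S : V -> set R) u S' w := if w == u then S' else S w.

Lemma cylinder_cons s S u S' : u \notin s ->
  cylinder (u :: s) (upd S u S') = cylinder s S `&` X u @^-1` S'.
Proof.
move=> us; apply/seteqP; split => t.
  move=> H; split.
    move=> w ws; have := H w; rewrite /= /upd in_cons.
    have /negPf -> : w != u by apply: contraNneq us => <-.
    by apply; rewrite /= in ws *.
  by have := H u; rewrite /= /upd eqxx; apply; rewrite in_cons eqxx.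
move=> [H1 H2] w /=; rewrite in_cons /upd.
by case: eqVneq => [->//|wu /=]; apply: H1.
Qed.

Lemma pr_cylinder_cons s S u S' : (forall w, measurable (S w)) -> measurable S' ->
  uniq (u :: s) ->
  pr (cylinder s S `&` X u @^-1` S') = pr (cylinder s S) * pr (X u @^-1` S').
Proof.
move=> mS mS' /= /andP[us uqs].
have mupd w : measurable (upd S u S' w) by rewrite /upd; case: ifP.
apply: EFin_inj; rewrite EFinM -!prE //; last 3 first.
- exact: mX.
- exact: measurable_cylinder.
- by apply: measurableI; [exact: measurable_cylinder|exact: mX].
rewrite -cylinder_cons // /cylinder (@Xind (u :: s)) //=; last by rewrite us.
rewrite big_cons /upd eqxx muleC; congr (_ * _)%E; rewrite Xind //.
rewrite big_seq [RHS]big_seq; apply: eq_bigr => w ws.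
by have /negPf -> : w != u by apply: contraNneq us => <-.
Qed.

Variables (a p : R).
Hypothesis Xp : forall u, pr (X u @^-1` `]a, +oo[) = p.

(** With [q] the factor of each hook this is the fraction of the deficit that is left; with constant
    [q] it is an exponential of the number of levels above [a]. *)
Definition weight q s t : R := \prod_(u <- s) (if a < X u t then q u else 1).

Lemma measurable_weight q s : measurable_fun setT (weight q s).
Proof.
elim: s => [|u s IH].
  rewrite (_ : weight q [::] = cst 1) //.
  by apply/funext => t; rewrite /weight big_nil.
rewrite (_ : weight q _ = fun t => (if a < X u t then q u else 1) * weight q s t).
  apply: measurable_funM => //; apply: measurable_fun_ifT => //.
  exact: measurable_fun_ltr.
by apply/funext => t; rewrite /weight big_cons.
Qed.

Lemma measurable_weight_ge q s (l : R) : measurable [set t | l <= weight q s t].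
Proof.
rewrite (_ : [set t | _] = weight q s @^-1` `[l, +oo[).
  by rewrite -[_ @^-1` _]setTI; apply: measurable_weight.
by apply/funext => t /=; rewrite in_itv /= andbT.
Qed.

(* Markov's inequality for a product of independent two-valued weights,
   relative to a cylinder on other coordinates; the latter makes an induction
   on s possible without computing any expectation. *)
Lemma markov_weight_cylinder q s s' S (l : R) : (forall u, 0 < q u) ->
  uniq (s ++ s') -> (forall u, measurable (S u)) -> 0 < l ->
  l * pr (cylinder s' S `&` [set t | l <= weight q s t]) <=
  pr (cylinder s' S) * \prod_(u <- s) (1 + (q u - 1) * p).
Proof.
move=> q0; elim: s s' S l => [|u s IH] s' S l /=.
  move=> _ mS l0; rewrite big_nil mulr1.
  have mC : measurable (cylinder s' S) by exact: measurable_cylinder.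
  have mW := measurable_weight_ge q [::] l.
  have [l1|l1] := leP l 1.
    apply: le_trans (_ : pr (cylinder s' S `&` [set t | l <= weight q [::] t]) <= _).
      by rewrite ler_piMl ?pr_ge0.
    by apply: pr_le => //; exact: measurableI.
  rewrite (_ : _ `&` _ = set0) ?/pr ?measure0 ?mulr0 ?pr_ge0 //.
  by rewrite -subset0 => t [_ /=]; rewrite /weight big_nil leNgt l1.
move=> uq mS l0.
have us' : u \notin s'.
  by move: uq; rewrite mem_cat negb_or => /andP[/andP[]].
have uqs' : uniq (s ++ u :: s').
  by have := uq; rewrite -(cat1s u s') uniq_catCA cat1s.
have uq' : uniq (u :: s').
  by move: uqs'; rewrite cat_uniq => /and3P[].
pose A : set R := [set` `]a, +oo[]; have mA : measurable A by exact: measurable_itv.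
have mCA : measurable (~` A) by exact: measurableC.
have mu1 w : measurable (upd S u A w) by rewrite /upd; case: ifP.
have mu2 w : measurable (upd S u (~` A) w) by rewrite /upd; case: ifP.
set D := cylinder s' S.
have mD : measurable D by exact: measurable_cylinder.
have lq0 : 0 < l / q u by rewrite divr_gt0.
(* Where [X u] exceeds [a], the factor [q u] is taken out and the threshold becomes [l / q u];
   elsewhere it stays [l]. In both cases [u] passes from the weight to the cylinder. *)
have H1 := IH (u :: s') (upd S u A) (l / q u) uqs' mu1 lq0.
have H2 := IH (u :: s') (upd S u (~` A)) l uqs' mu2 l0.
rewrite cylinder_cons // pr_cylinder_cons // Xp -/D in H1.
rewrite cylinder_cons // pr_cylinder_cons // -/D preimage_setC prC in H2; last exact: mX mA.
rewrite Xp in H2.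
set D1 := D `&` X u @^-1` A `&` [set t | l / q u <= weight q s t] in H1.
set D2 := D `&` ~` (X u @^-1` A) `&` [set t | l <= weight q s t] in H2.
have mXA : measurable (X u @^-1` A) by exact: mX mA.
have mD1 : measurable D1.
  by apply: measurableI; [exact: measurableI|exact: measurable_weight_ge].
have mD2 : measurable D2.
  apply: measurableI; last exact: measurable_weight_ge.
  by apply: measurableI => //; exact: measurableC.
have sub : D `&` [set t | l <= weight q (u :: s) t] `<=` D1 `|` D2.
  move=> t [Dt /=]; rewrite /weight big_cons -/(weight q s t).
  case: ifPn => at_ lw; [left|right]; split => //=.
  - by split => //; rewrite /A /= in_itv /= andbT.
  - by rewrite ler_pdivrMr // mulrC.
  - by split => //; rewrite /A /= in_itv /= andbT; exact/negP.
  - by rewrite mul1r in lw.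
have : pr (D `&` [set t | l <= weight q (u :: s) t]) <= pr D1 + pr D2.
  apply: le_trans (prU mD1 mD2); apply: pr_le => //.
    by apply: measurableI => //; exact: measurable_weight_ge.
  exact: measurableU.
rewrite big_cons; move: (\prod_(_ <- _) _) H1 H2 => Pi H1 H2 H.
apply: le_trans (_ : l * (pr D1 + pr D2) <= _); first by rewrite ler_pM2l.
have {}H1 : l * pr D1 <= q u * (pr D * p * Pi).
  by rewrite mulrAC ler_pdivrMr // [_ * q u]mulrC in H1.
have -> : pr D * ((1 + (q u - 1) * p) * Pi) =
  q u * (pr D * p * Pi) + pr D * (1 - p) * Pi by ring.
by rewrite mulrDr lerD.
Qed.

Lemma markov_weight q s (l : R) : (forall u, 0 < q u) -> uniq s -> 0 < l ->
  l * pr [set t | l <= weight q s t] <= \prod_(u <- s) (1 + (q u - 1) * p).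
Proof.
move=> q0 us l0.
have := @markov_weight_cylinder q s [::] (fun=> setT) l q0.
rewrite cats0 /cylinder => /(_ us (fun=> measurableT) l0).
by rewrite set_nil bigcap_set0 setTI {2}/pr probability_setT mul1r.
Qed.

End Independence.
End Probability.

Section IID.
Variables (V : choiceType) (d : measure_display) (T : measurableType d).
Variables (R : realType) (P : probability T R) (X : V -> {RV P >-> R}).
Hypothesis Xiid : iid_uniform01 X.

Lemma iid_pr_gt u (a : R) : 0 <= a <= 1 -> pr P (X u @^-1` `]a, +oo[) = 1 - a.
Proof.
move=> /andP[a0 a1]; have [_ /(_ u [set` `]a, +oo[] (measurable_itv _))] := Xiid.
rewrite uniform_prob01E // (_ : _ `&` _ = [set` `]a, 1]]); last first.
  apply/seteqP; split => x /=; rewrite !in_itv /= ?andbT.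
    by move=> [-> /andP[]].
  by move=> /andP[ax x1]; rewrite ax x1 andbT (le_trans a0) // ltW.
rewrite /distribution /pushforward /pr => ->; rewrite lebesgue_measure_itv /= lte_fin.
case: ltP => [//|]; move=> h; have -> : a = 1 by apply/eqP; rewrite eq_le a1.
by rewrite subrr.
Qed.

(** The upper bound is strict because the argument on the line needs positive deficits at the sites
    nearest to 0. *)
Lemma iid_bounds (u : V) : {ae P, forall t, 0 <= X u t < 1}.
Proof.
have mI : measurable [set` `[0 : R, 1[] by exact: measurable_itv.
have [_ /(_ u _ mI)] := Xiid.
rewrite uniform_prob01E // (_ : _ `&` _ = [set` `[0 : R, 1[]); last first.
  apply/seteqP; split => x /=; rewrite !in_itv /=; first by move=> [].
  by move=> /andP[x0 x1]; rewrite x0 x1 ltW.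
rewrite /distribution /pushforward lebesgue_measure_itv /= lte_fin ltr01 oppr0 adde0.
move=> H; have mX1 := mX X u mI.
exists (~` (X u @^-1` `[0, 1[)); split; first exact: measurableC.
  by rewrite probability_setC // H subee.
by move=> t; apply: contra_not => /=; rewrite in_itv.
Qed.

End IID.

Lemma ae_countable (V : choiceType) (d : measure_display) (T : measurableType d)
    (R : realType) (P : probability T R) (Q : V -> T -> Prop) :
  countable [set: V] -> (forall u, {ae P, forall t, Q u t}) ->
  {ae P, forall t, forall u, Q u t}.
Proof.
move=> /countable_injP[g ginj] H.
have : {ae P, forall t, forall n u, g u = n -> Q u t}.
  apply: ae_foralln => n.
  have [[u gu]|no] := pselect (exists u, g u = n).
    apply: filterS (H u) => t Qt w gw.
    by have -> : w = u by apply: ginj; rewrite ?inE // gu.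
  by apply: aeW => t u gu; exfalso; apply: no; exists u.
by apply: filterS => t h u; apply: (h (g u)).
Qed.

(** A division-free form of [\prod (1 - x_j) <= 1 / (1 + \sum x_j)], by which a divergent sum drives
    the product to 0. The induction rests on [(1 + S + x) * (1 - x) <= 1 + S]. *)
Lemma prod_sub1_le (R : realType) (x : nat -> R) J :
  (forall j, (j < J)%N -> 0 <= x j <= 1) ->
  0 <= \prod_(j < J) (1 - x j) /\
  (1 + \sum_(j < J) x j) * \prod_(j < J) (1 - x j) <= 1.
Proof.
elim: J => [|J IH] H; first by rewrite !big_ord0 addr0 mulr1.
have [|Pi0 PiS] := IH; first by move=> j jJ; apply: H; exact: ltnW.
have /andP[x0 x1] := H J (ltnSn J).
have S0 : 0 <= \sum_(j < J) x j.
  apply: sumr_ge0 => j _.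
  by have /andP[] := H j (ltnW (ltn_ord j)).
rewrite !big_ord_recr /=; move: (\prod_(_ < _) _) (\sum_(_ < _) _) Pi0 PiS S0.
move=> Pi S Pi0 PiS S0; split; first by rewrite mulr_ge0 // subr_ge0.
apply: le_trans PiS.
have -> : (1 + (S + x J)) * (Pi * (1 - x J)) =
  (1 + S) * Pi - Pi * (x J * (S + x J)) by ring.
by rewrite gerBl mulr_ge0 // mulr_ge0 // addr_ge0.
Qed.

Lemma harmonic_unbounded (R : realType) (A : R) :
  exists J, A < \sum_(j < J) j.+1%:R^-1.
Proof.
apply: contrapT => no; apply: (@dvg_harmonic R).
apply: nondecreasing_is_cvgn.
  apply: nondecreasing_series => n _ _; exact: harmonic_ge0.
exists A => _ [J _ <-]; rewrite leNgt; apply/negP => lt; apply: no; exists J.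
by rewrite -(big_mkord xpredT (fun j => j.+1%:R^-1)).
Qed.

(** * Graphs other than the line *)

Lemma prod_map_iota (V : Type) (R : realType) (F : V -> R) (u : nat -> V) J :
  \prod_(w <- [seq u j | j <- iota 0 J]) F w = \prod_(j < J) F (u j).
Proof. by rewrite big_map -{1}(subn0 J) -/(index_iota 0 J) big_mkord. Qed.

Section NonLine.
Variables (V : choiceType) (E : rel V) (d : measure_display).
Variables (T : measurableType d) (R : realType) (P : probability T R).
Variables (X : V -> {RV P >-> R}) (v w0 : V).
Hypotheses (Esym : symmetric E) (Eirr : irreflexive E).
Hypotheses (Vinf : infinite_set [set: V]) (Ec : graph_connected E).
Hypotheses (Eqt : quasi_transitive E) (Edeg : bounded_degree E).
Hypotheses (Xiid : iid_uniform01 X) (w0d : ~ degree_two E w0).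

(** For each [J] the fraction [Z] of the deficit left by [J] hooks is at least [l] with a
    probability that tends to 0 as [J] grows. Hence almost surely some [J] leaves less than [l]. *)
Lemma kappa_ge_ae (a l : R) : 0 < a < 1 -> 0 < l ->
  {ae P, forall t, (forall u, 0 <= X u t) ->
     ((a - a * l)%:E <= kappa E (fun u => X u t) v)%E}.
Proof.
move=> /andP[a0 a1] l0; have [Xind _] := Xiid.
have [C C0 hooks] := hooks_exist Edeg Esym Eirr Vinf Ec Eqt w0d.
have H J : exists Z : T -> R, [/\ measurable [set t | l <= Z t],
    l * pr P [set t | l <= Z t] *
      (1 + \sum_(j < J) (1 - a) / (j.+1 * C)%:R) <= 1 &
    forall t, (forall u, 0 <= X u t) ->
      ((a - a * Z t)%:E <= kappa E (fun u => X u t) v)%E].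
  have [p [k [u [pp up kC hk inj]]]] := hooks v J.
  pose s := [seq u j | j <- iota 0 J].
  (* The weight is indexed by vertices, so the position of a hook is recovered from its index in
     [s]. *)
  pose q w : R := (k (index w s)).+1%:R / (k (index w s)).+2%:R.
  have us : uniq s.
    rewrite map_inj_in_uniq ?iota_uniq // => i j; rewrite !mem_iota /= !add0n.
    move=> iJ jJ e; have [ij|ji|//] := ltngtP i j.
      by have [|_] := inj i j; rewrite ?ij // e eqxx.
    by have [|_] := inj j i; rewrite ?ji // e eqxx.
  have idx j : (j < J)%N -> index (u j) s = j.
    move=> jJ; rewrite -[in RHS](@index_uniq _ v j s) ?size_map ?size_iota //.
    by rewrite (nth_map 0%N) ?size_iota // nth_iota.
  have q0 w : 0 < q w by rewrite divr_gt0 ?ltr0n.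
  exists (weight X a q s); split.
  - exact: measurable_weight_ge.
  - have := @markov_weight _ _ _ _ _ _ Xind a (1 - a) (fun u => iid_pr_gt Xiid u
      (introT andP (conj (ltW a0) (ltW a1)))) q s l q0 us l0 => M.
    (* The expected loss at hook [j]: it is full with probability [1 - a], and then its factor is
       [1 - 1 / (k j + 2)]. *)
    pose x j : R := (1 - a) / (k j).+2%:R.
    have xj j : 0 <= x j <= 1.
      rewrite divr_ge0 ?subr_ge0 ?(ltW a1) //= ler_pdivrMr ?ltr0n // mul1r.
      apply: (@le_trans _ _ 1); first by rewrite gerBl ltW.
      by rewrite ler1n.
    have [Pi0 PiS] := @prod_sub1_le R x J (fun j _ => xj j).
    have eP : \prod_(u <- s) (1 + (q u - 1) * (1 - a)) = \prod_(j < J) (1 - x j).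
      rewrite prod_map_iota; apply: eq_bigr => j _; rewrite /q idx // /x -[(k j).+2%:R]natr1.
      have : (0 : R) < (k j).+1%:R by rewrite ltr0n.
      by move: (_.+1%:R) => m m0; field; rewrite gt_eqF // addr_gt0.
    rewrite eP in M.
    have S0 : 0 <= \sum_(j < J) (1 - a) / (j.+1 * C)%:R.
      by apply: sumr_ge0 => j _; rewrite divr_ge0 ?subr_ge0 ?(ltW a1).
    have SS : \sum_(j < J) (1 - a) / (j.+1 * C)%:R <= \sum_(j < J) x j.
      apply: ler_sum => j _; rewrite /x ler_pM2l ?subr_gt0 //.
      rewrite lef_pV2 ?posrE ?ltr0n ?muln_gt0 ?C0 //.
      by rewrite ler_nat kC.
    apply: le_trans PiS; rewrite mulrC; apply: ler_pM => //.
    + by rewrite addr_ge0.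
    + by rewrite mulr_ge0 ?pr_ge0 // ltW.
    + by rewrite lerD2l.
  - move=> t Xt.
    have [ms am le] := @hooked_path V E R Eirr v p J k u a 0 (fun u => X u t) pp up
      hk inj (Xt v) (fun i j _ _ => Xt _).
    apply: le_trans (kappa_ge_run _ _ am); rewrite lee_fin.
    apply: le_trans le; rewrite subr0.
    rewrite /weight prod_map_iota.
    rewrite (eq_bigr (fun j : 'I_J => hook_factor a (fun u => X u t) (k j) (u j))) //.
    by move=> j _; rewrite /q idx.
have [Z Zp] := choice H.
pose B := \bigcap_J [set t | l <= Z J t].
have mB : measurable B.
  by apply: bigcapT_measurable => J; have [] := Zp J.
have PB : P B = 0%E.
  rewrite prE //; congr EFin; apply/eqP; rewrite eq_le pr_ge0 andbT leNgt.
  apply/negP => pB.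
  pose c : R := (1 - a) / C%:R.
  have c0 : 0 < c by rewrite divr_gt0 ?subr_gt0 ?ltr0n.
  (* If [B] had positive probability, a partial harmonic sum this large would violate the Markov
     bound for [J] hooks. *)
  have [J JP] := @harmonic_unbounded R ((l * pr P B * c)^-1).
  have [mZ le _] := Zp J.
  have lB : l * pr P B <= l * pr P [set t | l <= Z J t].
    by rewrite ler_pM2l //; apply: pr_le => // t; exact.
  have lB0 : 0 < l * pr P B by rewrite mulr_gt0.
  move: le; apply/negP; rewrite -ltNge.
  have -> : \sum_(j < J) (1 - a) / (j.+1 * C)%:R = c * \sum_(j < J) j.+1%:R^-1.
    rewrite big_distrr /=; apply: eq_bigr => j _.
    by rewrite /c natrM invfM mulrA mulrAC.
  rewrite -ltr_pdivrMl ?(lt_le_trans lB0) // mulr1.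
  apply: (@le_lt_trans _ _ (l * pr P B)^-1).
    by rewrite lef_pV2 // posrE (lt_le_trans lB0).
  rewrite -[ltLHS]add0r; apply: ltr_leD => //.
  move: JP; rewrite [(_ * c)^-1]invfM mulrC ltr_pdivrMl // => /ltW.
  by [].
exists B; split => //.
move=> t; apply: contra_notP => nB Xt.
have [J /= nJ] : exists J, ~ l <= Z J t.
  by apply: contrapT => no; apply: nB => J _ /=; apply: contrapT => nl; apply: no; exists J.
have [_ _ /(_ t Xt)] := Zp J.
apply: le_trans; rewrite lee_fin lerB // ler_pM2l // ltW // ltNge.
exact/negP.
Qed.

Lemma kappa_eq1_ae : {ae P, forall t, kappa E (fun u => X u t) v = 1%E}.
Proof.
have cV := vertices_countable Edeg v Ec.
have Hb := ae_countable cV (iid_bounds Xiid).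
(* With [y = 1 / (n + 2)], taking [a = 1 - y] and [l = y] gives the lower bound [(1 - y) ^ 2], which
   tends to 1; the shift by 2 keeps [a] positive. *)
have Hk : {ae P, forall t, forall n : nat, (forall u, 0 <= X u t) ->
    (((1 - n.+2%:R^-1) - (1 - n.+2%:R^-1) * n.+2%:R^-1)%:E <=
      kappa E (fun u => X u t) v)%E}.
  apply: ae_foralln => n; apply: kappa_ge_ae; last by rewrite invr_gt0 ltr0n.
  rewrite subr_gt0 invf_lt1 ?ltr0n // ltr1n /= gtrBl invr_gt0 ltr0n //.
apply: filterS2 Hb Hk => t bt kt.
have Xt u : 0 <= X u t by have /andP[] := bt u.
apply/eqP; rewrite eq_le; apply/andP; split.
  by apply: kappa_le => u; have /andP[_ /ltW] := bt u.
apply/lee_addgt0Pr => e e0.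
have [n ne] : exists n : nat, 2 / e < n%:R.
  by exists (Num.bound (2 / e)); apply: archi_boundP; rewrite divr_ge0 // ltW.
have {}ne : 2 * n.+2%:R^-1 <= e.
  rewrite ler_pdivrMr ?ltr0n //; move: ne; rewrite ltr_pdivrMr // => /ltW ne.
  by apply: le_trans ne _; rewrite mulrC ler_pM2l // ler_nat !leqW.
apply: le_trans (_ : ((1 - n.+2%:R^-1) - (1 - n.+2%:R^-1) * n.+2%:R^-1 + e)%:E <= _)%E.
  rewrite lee_fin; have := sqr_ge0 (n.+2%:R^-1 : R); move: ne.
  move: (n.+2%:R^-1) => y ye y2; rewrite mulrBl mul1r -expr2; lra.
rewrite EFinD leeD2r //; exact: kt.
Qed.

End NonLine.

(** * Weights on the line *)

Section SAD.
Variable R : realType.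
Implicit Types (F xi eta : int -> R).

Lemma line_step_normal (m : move int R) : admissible line_graph m ->
  exists k : int, exists2 mu : R, 0 <= mu <= 2^-1 &
    (forall eta, water_step eta m = water_step eta ((k, k + 1), mu)) /\
    ((m.1.1 = k /\ m.1.2 = k + 1) \/ (m.1.2 = k /\ m.1.1 = k + 1)).
Proof.
case: m => [[x y] mu] /andP[/= /orP[]/eqP -> mu01].
  by exists x, mu => //; split => //; left.
exists y, mu => //; split; last by right.
by move=> eta; apply: water_stepC; apply/eqP; lia.
Qed.

Definition relax F (j : int) (mu : R) z :=
  if z == j then (1 - 2 * mu) * F z + mu * (F (z - 1) + F (z + 1)) else F z.

(* A move on the edge <k, k+1> changes the cumulative profile only at k+1,
   which is pulled towards the mean of its two neighbours. *)
Lemma step_relax F xi k mu : (forall z, xi z = F (z + 1) - F z) ->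
  forall z, water_step xi ((k, k + 1), mu) z =
    relax F (k + 1) mu (z + 1) - relax F (k + 1) mu z.
Proof.
move=> FE z; rewrite /= /relax.
have [->|zk] := eqVneq z k.
  rewrite eqxx ifN; last by apply/eqP; lia.
  by rewrite !FE addrK; ring.
have [->|zk1] := eqVneq z (k + 1).
  rewrite ifN; last by apply/eqP; lia.
  by rewrite !FE addrK; ring.
rewrite ifN; last by apply/eqP; move/eqP: zk; lia.
by rewrite FE.
Qed.

(* [spread F] says that the mass of the interval [a, b) is at most 1 - a / b:
   the mass that reaches a must leave as much at each site before it. *)
Definition spread F := (forall z, 0 <= F z <= 1) /\
  forall a b : int, 0 <= a <= b -> 0 < b -> F b - F a <= 1 - a%:~R / b%:~R.

Lemma convex3_le (mu a b c m : R) : 0 <= mu <= 2^-1 -> a <= m -> b + c <= 2 * m ->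
  (1 - 2 * mu) * a + mu * (b + c) <= m.
Proof.
move=> /andP[mu0 mu1] am bcm.
have -> : m = (1 - 2 * mu) * m + mu * (2 * m) by ring.
by apply: lerD; apply: ler_wpM2l => //; lra.
Qed.

Lemma relax_bounds F j mu : 0 <= mu <= 2^-1 -> (forall z, 0 <= F z <= 1) ->
  forall z, 0 <= relax F j mu z <= 1.
Proof.
move=> mu01 H z; have /andP[mu0 mu1] := mu01; rewrite /relax; case: ifP => _ //.
have /andP[a0 a1] := H z; have /andP[b0 b1] := H (z - 1).
have /andP[c0 c1] := H (z + 1); apply/andP; split.
  by apply: addr_ge0; apply: mulr_ge0 => //; [lra|exact: addr_ge0].
by apply: convex3_le => //; lra.
Qed.

(** For [0 < a < b] at most one endpoint is relaxed. The bound [1 - a / b] is concave in [b] and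
    affine in [a], so it is at least the mean of its values at the two neighbours of that endpoint.
    For [a = 0] and [a = b] it is immediate. *)
Lemma relax_spread F j mu : 0 <= mu <= 2^-1 -> spread F -> spread (relax F j mu).
Proof.
move=> mu01 [F01 FS]; have G01 := relax_bounds j mu01 F01.
split => // a b /andP[a0 ab] b0.
have bR : 0 < b%:~R :> R by rewrite ltr0z.
have [a00|an0] := eqVneq a 0.
  rewrite a00 mul0r subr0; have /andP[_ h1] := G01 b.
  by have /andP[h2 _] := G01 0; lra.
have a1 : 0 < a by rewrite lt_neqAle eq_sym an0.
have aR : 0 < a%:~R :> R by rewrite ltr0z.
have [<-|anb] := eqVneq a b; first by rewrite subrr divff ?subrr // gt_eqF.
have ltab : a < b by rewrite lt_neqAle anb.
rewrite /relax; have [bj|bj] := eqVneq b j; have [aj|aj] := eqVneq a j.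
- by move: anb; rewrite aj bj eqxx.
- rewrite -lerBrDr opprK; apply: convex3_le => //.
    by rewrite -lerBlDr; apply: FS => //; lia.
  have h1 : F (b - 1) - F a <= 1 - a%:~R / (b - 1)%:~R by apply: FS; lia.
  have h2 : F (b + 1) - F a <= 1 - a%:~R / (b + 1)%:~R by apply: FS; lia.
  have b1R : 0 < (b - 1)%:~R :> R by rewrite ltr0z; lia.
  have h3 : 2 * (a%:~R / b%:~R) <= a%:~R / (b - 1)%:~R + a%:~R / (b + 1)%:~R :> R.
    move: b1R; rewrite intrB intrD; move: (b%:~R) (a%:~R) bR aR => y x y0 x0 y1.
    rewrite -subr_ge0.
    have -> : x / (y - 1) + x / (y + 1) - 2 * (x / y) =
        2 * x / (y * (y - 1) * (y + 1)).
      by field; rewrite !gt_eqF //= addr_gt0.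
    by apply: divr_ge0; apply: ltW; rewrite !mulr_gt0 // (addr_gt0 y0 ltr01).
  move: h1 h2 h3; move: (F (b - 1)) (F (b + 1)) (F a) (_ / b%:~R).
  by move: (_ / (b - 1)%:~R) (_ / (b + 1)%:~R) => *; lra.
- rewrite lerBlDl -lerBlDr -lerN2.
  have h1 : F b - F (a - 1) <= 1 - (a - 1)%:~R / b%:~R by apply: FS; lia.
  have h2 : F b - F (a + 1) <= 1 - (a + 1)%:~R / b%:~R by apply: FS; lia.
  have h3 : F b - F a <= 1 - a%:~R / b%:~R by apply: FS; lia.
  have -> : - ((1 - 2 * mu) * F a + mu * (F (a - 1) + F (a + 1))) =
     (1 - 2 * mu) * (- F a) + mu * (- F (a - 1) + - F (a + 1)) by ring.
  apply: convex3_le => //; first lra.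
  move: h1 h2; rewrite intrB intrD !mulrDl mulNr.
  by move: (F (a - 1)) (F (a + 1)) (F b) (a%:~R / _) (1 / _) => *; lra.
- by apply: FS => //; rewrite a0.
Qed.

(* If F is the cumulative profile of xi, this is that of z |-> xi (- z). *)
Definition mirror F z := 1 - F (1 - z).

Lemma mirror_relax F j mu : mirror (relax F j mu) = relax (mirror F) (1 - j) mu.
Proof.
apply/funext => z; rewrite /mirror /relax.
have -> : (1 - z == j) = (z == 1 - j) by apply/eqP/eqP; lia.
case: ifP => // _.
have -> : 1 - (z - 1) = 1 - z + 1 by lia.
have -> : 1 - (z + 1) = 1 - z - 1 by lia.
ring.
Qed.

Definition unimodal xi := exists m,
  (forall z, z < m -> xi z <= xi (z + 1)) /\
  (forall z, m <= z -> xi (z + 1) <= xi z).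

(** Only the comparisons at [k - 1], [k] and [k + 1] can change, and the peak shifts by at most one
    site, away from the edge. *)
Lemma step_unimodal xi k mu : 0 <= mu <= 2^-1 -> unimodal xi ->
  unimodal (water_step xi ((k, k + 1), mu)).
Proof.
move=> /andP[mu0 mu1] [m [up down]].
set xi' := water_step _ _.
have ek : xi' k = xi k + mu * (xi (k + 1) - xi k) by rewrite /xi' /= eqxx.
have ek1 : xi' (k + 1) = xi (k + 1) + mu * (xi k - xi (k + 1)).
  by rewrite /xi' /= ifN ?eqxx //; apply/eqP; lia.
have eo z : z <> k -> z <> k + 1 -> xi' z = xi z.
  by move=> /eqP/negPf h1 /eqP/negPf h2; rewrite /xi' /= h1 h2.
(* This settles the cases where the order across the edge opposes the side of the peak: the two
   levels are then equal. *)
have same : xi (k + 1) = xi k -> unimodal xi'.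
  move=> e; exists m; have -> : xi' = xi; last by split.
  apply/funext => z; have [->|n1] := pselect (z = k).
    by rewrite ek e subrr mulr0 addr0.
  have [->|n2] := pselect (z = k + 1); last exact: eo.
  by rewrite ek1 e subrr mulr0 addr0.
have key m' : (forall z, z < m' -> z <> k - 1 -> z <> k -> z <> k + 1 ->
      xi z <= xi (z + 1)) ->
    (forall z, m' <= z -> z <> k - 1 -> z <> k -> z <> k + 1 -> xi (z + 1) <= xi z) ->
    (if k - 1 < m' then xi (k - 1) <= xi' k else xi' k <= xi (k - 1)) ->
    (if k < m' then xi' k <= xi' (k + 1) else xi' (k + 1) <= xi' k) ->
    (if k + 1 < m' then xi' (k + 1) <= xi (k + 2) else xi (k + 2) <= xi' (k + 1)) ->
    unimodal xi'.
  move=> H1 H2 h1 h2 h3; exists m'; split=> z zm.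
    have [e|n1] := pselect (z = k - 1).
      by move: h1; rewrite -e zm e subrK (eo (k - 1)) //; lia.
    have [e|n2] := pselect (z = k); first by move: h2; rewrite -e zm.
    have [e|n3] := pselect (z = k + 1).
      move: h3; rewrite -e zm (eo (z + 1)); [|lia|lia].
      by have -> : z + 1 = k + 2 by lia.
    by rewrite !eo; [exact: H1|lia..].
  have zm' : (z < m') = false by lia.
  have [e|n1] := pselect (z = k - 1).
    by move: h1; rewrite -e zm' e subrK (eo (k - 1)) //; lia.
  have [e|n2] := pselect (z = k); first by move: h2; rewrite -e zm'.
  have [e|n3] := pselect (z = k + 1).
    move: h3; rewrite -e zm' (eo (z + 1)); [|lia|lia].
    by have -> : z + 1 = k + 2 by lia.
  by rewrite !eo; [exact: H2|lia..].
have upk := up k; have downk := down k.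
have upk' : k - 1 < m -> xi (k - 1) <= xi k.
  by move=> /up; rewrite subrK.
have downk' : m <= k - 1 -> xi k <= xi (k - 1).
  by move=> /down; rewrite subrK.
have upk1 : k + 1 < m -> xi (k + 1) <= xi (k + 2).
  by move=> /up; have -> : k + 1 + 1 = k + 2 by lia.
have downk1 : m <= k + 1 -> xi (k + 2) <= xi (k + 1).
  by move=> /down; have -> : k + 1 + 1 = k + 2 by lia.
(* after the move the levels at k and k + 1 lie between the old ones, in the
   same order *)
have [le|/ltW le] := leP (xi k) (xi (k + 1)).
  have b1 : xi k <= xi' k by rewrite ek lerDl mulr_ge0 // subr_ge0.
  have b2 : xi' k <= xi' (k + 1).
    by rewrite ek ek1 -subr_ge0 (_ : _ - _ = (1 - 2 * mu) * (xi (k + 1) - xi k));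
      [rewrite mulr_ge0 ?subr_ge0 //; lra|ring].
  have b3 : xi' (k + 1) <= xi (k + 1).
    by rewrite ek1 gerDl mulr_ge0_le0 // subr_le0.
  have [mk|km] := lerP m k.
    by apply: same; apply/eqP; rewrite eq_le le downk.
  have mk1 : k - 1 < m by move: km; clear; lia.
  have h1 := le_trans (upk' mk1) b1.
  (* The peak [k + 1] is lowered by the move; if it falls below the level at [k + 2], the latter
     becomes the peak. The case [m = k] further down is symmetric. *)
  have [mk2|mk2] := pselect (m = k + 1).
    have [l|l] := leP (xi (k + 2)) (xi' (k + 1)).
      apply: (key m); rewrite ?mk1 ?km //; first by move=> z zm _ _ _; exact: up.
        by move=> z zm _ _ _; exact: down.
      by rewrite mk2 ltxx.
    apply: (key (k + 2)).
    + by move=> z zk _ _ nk1; apply: up; move: zk nk1 mk2; clear; lia.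
    + by move=> z zk _ _ _; apply: down; move: zk mk2; clear; lia.
    + by rewrite ifT //; clear; lia.
    + by rewrite ifT //; clear; lia.
    + by rewrite ifT ?ltW //; clear; lia.
  have km1 : k + 1 < m by move: km mk2; clear; lia.
  apply: (key m); rewrite ?mk1 ?km ?km1 //; first by move=> z zm _ _ _; exact: up.
    by move=> z zm _ _ _; exact: down.
  by apply: le_trans b3 _; exact: upk1.
have b1 : xi' k <= xi k by rewrite ek gerDl mulr_ge0_le0 // subr_le0.
have b2 : xi' (k + 1) <= xi' k.
  by rewrite ek ek1 -subr_ge0 (_ : _ - _ = (1 - 2 * mu) * (xi k - xi (k + 1)));
    [rewrite mulr_ge0 ?subr_ge0 //; lra|ring].
have b3 : xi (k + 1) <= xi' (k + 1) by rewrite ek1 lerDl mulr_ge0 // subr_ge0.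
have [mk|km] := lerP m k; last first.
  by apply: same; apply/eqP; rewrite eq_le le upk.
have km' : (k < m) = false by move: mk; clear; lia.
have km1 : (k + 1 < m) = false by move: mk; clear; lia.
have d1 : xi (k + 2) <= xi' (k + 1).
  by apply: le_trans b3; apply: downk1; move: mk; clear; lia.
have [mk2|mk2] := pselect (m = k).
  have [l|l] := leP (xi (k - 1)) (xi' k).
    apply: (key m); rewrite ?km' ?km1 //; first by move=> z zm _ _ _; exact: up.
      by move=> z zm _ _ _; exact: down.
    by rewrite ifT // mk2; clear; lia.
  apply: (key (k - 1)).
  + by move=> z zk _ _ _; apply: up; move: zk mk2; clear; lia.
  + by move=> z zk nk _ _; apply: down; move: zk nk mk2; clear; lia.
  + by rewrite ltxx ltW.
  + by rewrite ifF //; clear; lia.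
  + by rewrite ifF //; clear; lia.
have mk1 : (k - 1 < m) = false by move: mk mk2; clear; lia.
apply: (key m); rewrite ?mk1 ?km' ?km1 //; first by move=> z zm _ _ _; exact: up.
  by move=> z zm _ _ _; exact: down.
by apply: le_trans b1 _; apply: downk'; move: mk1; clear; lia.
Qed.

End SAD.

(** * Bounding the level at 0 through its weights *)

Section LineBound.
Variable R : realType.
Implicit Types (xi eta : int -> R).

(** The interval [-N, N), listed so that sums split into two half-lines; [Negz i] is the site -(i +
    1), so 0 belongs to the first half. *)
Definition int_range N : seq int :=
  [seq Posz i | i <- iota 0 N] ++ [seq Negz i | i <- iota 0 N].

Lemma mem_int_range N (z : int) : (z \in int_range N) = (- N%:Z <= z < N%:Z).
Proof.
rewrite mem_cat; apply/orP/idP => [[]/mapP[i]|].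
- by rewrite mem_iota => h ->; lia.
- by rewrite mem_iota => h ->; lia.
case: z => n h; [left|right]; rewrite mem_map ?mem_iota; try lia.
- by move=> i j [].
- by move=> i j [].
Qed.

Lemma int_range_uniq N : uniq (int_range N).
Proof.
rewrite cat_uniq !map_inj_uniq ?iota_uniq ?andbT /=; last 2 first.
- by move=> i j [].
- by move=> i j [].
by apply/hasPn => _ /mapP[i _ ->]; apply/mapP => -[].
Qed.

Lemma sum_int_range (h : int -> R) N : \sum_(z <- int_range N) h z =
  \sum_(i < N) h (Posz i) + \sum_(i < N) h (Negz i).
Proof.
by rewrite big_cat !big_map -{1 2}(subn0 N) -/(index_iota 0 N) !big_mkord.
Qed.

(** The matrix of a move is symmetric, so the move can be shifted from the profile to the weight. *)
Lemma step_self_adjoint s xi eta (m : move int R) : uniq s ->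
  m.1.1 \in s -> m.1.2 \in s -> m.1.1 != m.1.2 ->
  \sum_(z <- s) xi z * water_step eta m z = \sum_(z <- s) water_step xi m z * eta z.
Proof.
case: m => [[x y] mu] /= us xs ys xy; apply/eqP; rewrite -subr_eq0; apply/eqP.
rewrite (@big_swap2 _ _ _ _ x y) //; last by move=> w /negPf -> /negPf ->.
by rewrite !eqxx eq_sym (negPf xy); ring.
Qed.

(* Dually, the final level at 0 is a weighted mean of the initial levels; the
   weights arise from the unit mass at 0 by the moves in reverse order. *)
Lemma sad_exists (ms : seq (move int R)) : all (@admissible _ line_graph R) ms ->
  exists xi, [/\ forall z, 0 <= xi z, unimodal xi,
    exists F, [/\ forall z, xi z = F (z + 1) - F z, spread F & spread (mirror F)] &
    exists N0, forall N eta, (N0 <= N)%N ->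
      water_run eta ms 0 = \sum_(z <- int_range N) xi z * eta z].
Proof.
elim: ms => [_|m ms IH /= /andP[am ams]].
  exists (fun z => (z == 0)%:R); split.
  - by move=> z; rewrite ler0n.
  - exists 0; split => z z0.
      by rewrite (_ : (z == 0) = false) ?ler0n //; lia.
    by rewrite (_ : (z + 1 == 0) = false) ?ler0n //; lia.
  (* The cumulative profile of the unit mass at 0 is the indicator of [0 < z], which is its own
     mirror. *)
  - have S0 : spread (fun z => (0 < z)%R%:R : R).
      split=> [z|a b ab b0]; first by case: (0 < z); rewrite lexx ler01.
      rewrite b0; have [a0|a0] := ltP 0 a.
        rewrite subrr subr_ge0 ler_pdivrMr ?ltr0z // mul1r ler_int.
        by case/andP: ab.
      have -> : a = 0 by lia.
      by rewrite mul0r.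
    exists (fun z => (0 < z)%R%:R); split => //.
      move=> z; have [->|z0] := eqVneq z 0; first by rewrite add0r ltxx subr0.
      by rewrite (_ : (0 < z + 1) = (0 < z)) ?subrr //; lia.
    rewrite (_ : mirror _ = fun z => (0 < z)%R%:R) //.
    apply/funext => z; rewrite /mirror (_ : (0 < 1 - z) = ~~ (0 < z)); last by lia.
    by case: (0 < z); rewrite ?subr0 ?subrr.
  - exists 1%N => N eta N1.
    have r0 : 0 \in int_range N by rewrite mem_int_range; move: N1; lia.
    rewrite (bigD1_seq _ r0 (int_range_uniq N)) /= mul1r.
    by rewrite big1 ?addr0 // => z /negPf ->; rewrite mul0r.
have [xi [xi0 xiU [F [FE FS FS']] [N0 xiE]]] := IH ams.
have [k [mu mu01 [stepE mk]]] := line_step_normal am.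
exists (water_step xi m); split.
- rewrite stepE => z /=; have /andP[mu0 mu1] := mu01.
  have h u w : 0 <= xi u + mu * (xi w - xi u).
    have -> : xi u + mu * (xi w - xi u) = (1 - mu) * xi u + mu * xi w by ring.
    by apply: addr_ge0; apply: mulr_ge0 => //; lra.
  by case: ifP => _ //; case: ifP.
- by rewrite stepE; exact: step_unimodal.
- exists (relax F (k + 1) mu); split.
  + by rewrite stepE; exact: step_relax.
  + exact: relax_spread.
  + by rewrite mirror_relax; exact: relax_spread.
exists (maxn N0 (`|k| + 2)) => N eta; rewrite geq_max => /andP[N0N kN].
rewrite -[LHS]/(water_run (water_step eta m) ms 0) (xiE N (water_step eta m) N0N).
have ir : (k \in int_range N) && (k + 1 \in int_range N).
  by rewrite !mem_int_range; move: kN; clear; lia.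
have /andP[kr k1r] := ir.
apply: step_self_adjoint; rewrite ?int_range_uniq //.
- by case: mk => -[e1 e2]; rewrite ?e1 ?e2.
- by case: mk => -[e1 e2]; rewrite ?e1 ?e2.
- by apply/eqP; case: mk => -[-> ->]; clear; lia.
Qed.

(** The case [a = n], [b = n + 1] of [spread], where [1 - a / b = 1 / (n + 1)]. *)
Lemma spread_peak (F : int -> R) (n : nat) : spread F -> (F (n%:Z + 1) - F n%:Z) * n.+1%:R <= 1.
Proof.
move=> [_ FS]; have := FS n%:Z (n%:Z + 1).
have -> : (n%:Z + 1)%:~R = n.+1%:R :> R by rewrite -PoszD addn1.
have nn : (n%:Z)%:~R = n.+1%:R - 1 :> R by rewrite -natr1 addrK.
rewrite nn -ler_pdivlMr ?ltr0n // mulrBl divff ?pnatr_eq0 // opprB addrCA subrr addr0.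
by apply; lia.
Qed.

(** Summation by parts: the sum dominates [a N] times the last partial sum of [b]. *)
Lemma abel_ge0 (a b : nat -> R) N : (forall n, 0 <= a n) ->
  (forall n, a n.+1 <= a n) -> (forall n, 0 <= \sum_(i < n) b i) ->
  0 <= \sum_(i < N) a i * b i.
Proof.
move=> a0 adec B0; apply: le_trans (_ : a N * \sum_(i < N) b i <= _).
  by rewrite mulr_ge0.
elim: N => [|N IH]; first by rewrite !big_ord0 mulr0.
apply: le_trans (_ : a N * \sum_(i < N.+1) b i <= _).
  by rewrite ler_wpM2r.
by rewrite !big_ord_recr /= mulrDr lerD2r.
Qed.

(** In use [zeta] is the deficit [1 - eta], so low sites are those with [eta > 1 - tau]. *)
Definition low (tau : R) (zeta : nat -> R) n : R := (zeta n < tau)%R%:R.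

Definition rarely_low tau zeta :=
  forall n, 6 * \sum_(i < n) low tau zeta i <= n%:R.

Lemma rarely_low_sum (a zeta : nat -> R) tau N : (forall n, 0 <= a n) ->
  (forall n, a n.+1 <= a n) -> rarely_low tau zeta ->
  6 * \sum_(i < N) a i * low tau zeta i <= \sum_(i < N) a i.
Proof.
move=> a0 adec H; rewrite -subr_ge0 big_distrr /= -sumrB.
rewrite (eq_bigr (fun i : 'I_N => a i * (1 - 6 * low tau zeta i))); last first.
  by move=> i _; ring.
apply: (@abel_ge0 a (fun i => 1 - 6 * low tau zeta i)) => // n.
rewrite sumrB -big_distrr /= sumr_const card_ord subr_ge0; exact: H.
Qed.

(* Before its peak M the weight a is replaced by the constant a M, which adds
   at most (M + 1) * a M <= 1 to the total weight. *)
Lemma peaked_low_sum (a zeta : nat -> R) tau N M : (forall n, 0 <= a n) ->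
  (forall n, (n < M)%N -> a n <= a n.+1) -> (forall n, (M <= n)%N -> a n.+1 <= a n) ->
  a M * M.+1%:R <= 1 -> rarely_low tau zeta ->
  6 * \sum_(i < N) a i * low tau zeta i <= 1 + \sum_(i < N) a i.
Proof.
move=> a0 up down peak H.
pose b n := if (n <= M)%N then a M else a n.
have upM m : forall n, (n + m)%N = M -> a n <= a M.
  elim: m => [|m IH] n; first by rewrite addn0 => ->.
  move=> e; apply: le_trans (IH n.+1 _); last by rewrite addSnnS.
  by apply: up; rewrite -e; lia.
have ab n : a n <= b n.
  by rewrite /b; case: leqP => // nM; apply: (upM (M - n)%N); rewrite subnKC.
have low0 n : 0 <= low tau zeta n by rewrite ler0n.
have bdec n : b n.+1 <= b n.
  rewrite /b; have [ltnM|leMn] := ltnP n M; first by rewrite ltnW.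
  have [nM|ltMn] := leqP n M.
    have -> : n = M by apply/eqP; rewrite eqn_leq nM leMn.
    exact: down.
  exact: down.
have b0 n : 0 <= b n by apply: le_trans (ab n).
apply: le_trans (le_trans (rarely_low_sum N b0 bdec H) _).
  by rewrite ler_pM2l //; apply: ler_sum => i _; exact: ler_wpM2r.
apply: le_trans (_ : \sum_(i < N) (a M * (i <= M)%:R + a i) <= _).
  apply: ler_sum => i _; rewrite /b; case: ifP => _.
    by rewrite mulr1 lerDl.
  by rewrite mulr0 add0r.
rewrite big_split /= lerD2r -big_distrr /=; apply: le_trans peak.
apply: ler_wpM2l => //.
have -> : \sum_(i < N) (i <= M)%:R = (minn N M.+1)%:R :> R.
  elim: N => [|N IH]; first by rewrite big_ord0 min0n.
  by rewrite big_ord_recr /= IH -natrD; congr _%:R; lia.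
by rewrite ler_nat geq_minr.
Qed.

(** Low sites carry mass at most [(1 + 1) / 6], the extra 1 coming from the side [a] of the peak.
    The other sites carry at least 2/3, each with value at least [tau]. *)
Lemma peaked_mean_ge (a b za zb : nat -> R) tau N M : 0 < tau ->
  (forall n, 0 <= a n) -> (forall n, 0 <= b n) ->
  (forall n, 0 <= za n) -> (forall n, 0 <= zb n) ->
  (forall n, (n < M)%N -> a n <= a n.+1) -> (forall n, (M <= n)%N -> a n.+1 <= a n) ->
  a M * M.+1%:R <= 1 -> (forall n, b n.+1 <= b n) ->
  \sum_(i < N) a i + \sum_(i < N) b i = 1 ->
  rarely_low tau za -> rarely_low tau zb ->
  tau / 2 <= \sum_(i < N) a i * za i + \sum_(i < N) b i * zb i.
Proof.
move=> tau0 a0 b0 za0 zb0 up down peak bdec mass Ha Hb.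
have h1 := peaked_low_sum N a0 up down peak Ha.
have h2 := rarely_low_sum N b0 bdec Hb.
have key (c z : nat -> R) : (forall n, 0 <= c n) -> (forall n, 0 <= z n) ->
    tau * (\sum_(i < N) c i - \sum_(i < N) c i * low tau z i) <=
    \sum_(i < N) c i * z i.
  move=> c0 z0; rewrite -sumrB big_distrr /=; apply: ler_sum => i _.
  rewrite /low; case: ltP => zt; rewrite /= ?mulr1 ?mulr0 ?subr0 ?subrr ?mulr0.
    by rewrite mulr_ge0.
  by rewrite mulrC ler_wpM2l.
apply: le_trans (lerD (key a za a0 za0) (key b zb b0 zb0)).
rewrite -mulrDr; apply: ler_wpM2l; first exact: ltW.
move: h1 h2 mass.
move: (\sum_(_ < N) a _ * _) (\sum_(_ < N) b _ * _) => x y.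
move: (\sum_(_ < N) _) (\sum_(_ < N) _) => u w; lra.
Qed.

Lemma line_run_le eta (tau : R) (ms : seq (move int R)) :
  all (@admissible _ line_graph R) ms -> 0 < tau -> (forall z, eta z <= 1) ->
  rarely_low tau (fun n => 1 - eta (Posz n)) ->
  rarely_low tau (fun n => 1 - eta (Negz n)) ->
  water_run eta ms 0 <= 1 - tau / 2.
Proof.
move=> am tau0 eta1 Hp Hn.
have [xi [xi0 [m [up down]] [F [FE FS FS']] [N0 xiE]]] := sad_exists am.
(* The constant profile 1 is preserved by every move, so [xi] has total mass 1. *)
have run1 : water_run (fun=> 1) ms 0 = 1.
  elim: (ms) => //= -[[x y] mu] ms' IH; rewrite -[RHS]IH; congr (water_run _ ms' 0).
  by apply/funext => z /=; case: ifP => _; [|case: ifP => _]; ring.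
have mass := xiE N0 (fun=> 1) (leqnn _).
rewrite run1 sum_int_range in mass.
have zeta0 z : 0 <= 1 - eta z by rewrite subr_ge0.
have -> : water_run eta ms 0 = 1 - (\sum_(i < N0) xi (Posz i) * (1 - eta (Posz i)) +
    \sum_(i < N0) xi (Negz i) * (1 - eta (Negz i))).
  rewrite -(sum_int_range (fun z => xi z * (1 - eta z))).
  rewrite (eq_bigr (fun z => xi z * 1 - xi z * eta z)); last by move=> z _; ring.
  by rewrite sumrB -xiE // -xiE // run1 opprB addrC subrK.
rewrite lerD2l lerN2.
have peakp n : xi (Posz n) * n.+1%:R <= 1 by rewrite FE; exact: spread_peak.
(* The site is -(n + 1), so the mirrored profile gives even [1 / (n + 2)]. *)
have peakn n : xi (Negz n) * n.+1%:R <= 1.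
  have := spread_peak n.+1 FS'; rewrite /mirror.
  have -> : 1 - (n.+1%:Z + 1) = Negz n by rewrite NegzE; lia.
  have -> : 1 - n.+1%:Z = Negz n + 1 by rewrite NegzE; lia.
  have -> : 1 - F (Negz n) - (1 - F (Negz n + 1)) = xi (Negz n) by rewrite FE; ring.
  by apply: le_trans; rewrite ler_wpM2l // ler_nat.
have eqS n : Posz n + 1 = Posz n.+1 by rewrite -PoszD addn1.
have eqN n : Negz n.+1 + 1 = Negz n by rewrite !NegzE; lia.
(* The half-line containing the peak has the role of [a]; on the other one the weight decreases away
   from 0. *)
case: m up down => M up down.
  apply: (@peaked_mean_ge (fun n => xi (Posz n)) (fun n => xi (Negz n))
    (fun n => 1 - eta (Posz n)) (fun n => 1 - eta (Negz n)) tau N0 M) => //.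
  - by move=> n nM; rewrite -eqS; apply: up.
  - by move=> n nM; rewrite -eqS; apply: down.
  - by move=> n; rewrite -(eqN n); apply: up.
  - by rewrite mass; congr (_ + _); apply: eq_bigr => i _; rewrite mulr1.
rewrite addrC; apply: (@peaked_mean_ge (fun n => xi (Negz n))
  (fun n => xi (Posz n)) (fun n => 1 - eta (Negz n)) (fun n => 1 - eta (Posz n))
  tau N0 M) => //.
- by move=> n nM; rewrite -(eqN n); apply: down; rewrite !NegzE; lia.
- by move=> n nM; rewrite -(eqN n); apply: up; rewrite !NegzE; lia.
- by move=> n; rewrite -eqS; apply: down.
- by rewrite mass addrC; congr (_ + _); apply: eq_bigr => i _; rewrite mulr1.
Qed.

End LineBound.

(** * The line *)

Section Measurability.
Variables (V : choiceType) (E : rel V) (d : measure_display).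
Variables (T : measurableType d) (R : realType).
Implicit Types (Y : V -> T -> R).

Lemma measurable_water_run Y (ms : seq (move V R)) w :
  (forall u, measurable_fun setT (Y u)) ->
  measurable_fun setT (fun t => water_run (fun u => Y u t) ms w).
Proof.
elim: ms Y => [|m ms IH] Y mY; first exact: mY.
apply: (IH (fun u t => water_step (fun u => Y u t) m u)) => u.
case: m => [[x y] mu] /=.
by case: (u == x); [|case: (u == y) => //]; apply: measurable_funD => //;
  apply: measurable_funM => //; apply: measurable_funB.
Qed.

(** Half moves suffice by [water_run_half], and there are countably many finite lists of edges;
    [kappa] is thus a countable supremum of measurable levels. *)
Lemma measurable_kappa Y v : countable [set: V] ->
  (forall u, measurable_fun setT (Y u)) ->
  measurable_fun setT (fun t => kappa E (fun u => Y u t) v).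
Proof.
move=> /countable_injP[g ginj] mY.
have gI : injective g by move=> x y; apply: ginj; rewrite inE.
pose code (es : seq (V * V)) := pickle [seq (g e.1, g e.2) | e <- es].
have codeI : injective code.
  move=> es es' /(pcan_inj pickleK); apply: inj_map => -[a b] [a' b'] /=.
  by move=> [/gI -> /gI ->].
(* Numbers that code no list of edges are decoded as the empty list, whose level is reachable as
   well. *)
have H n : exists es, all (fun e => E e.1 e.2) es /\
    forall es', all (fun e => E e.1 e.2) es' -> code es' = n -> es' = es.
  have [[es [Ees esn]]|no] := pselect (exists es, all (fun e => E e.1 e.2) es /\ code es = n).
    by exists es; split => // es' _ en; apply: codeI; rewrite en.
  by exists [::]; split => // es' h1 h2; exfalso; apply: no; exists es'.
have [e eP] := choice H.
pose h n t : \bar R := (water_run (fun u => Y u t) [seq (x, 2^-1) | x <- e n] v)%:E.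
rewrite (_ : (fun t => _) = fun t => esups (h^~ t) 0).
  apply: measurable_fun_esups => n; apply/measurable_EFinP.
  exact: measurable_water_run.
apply/funext => t; apply/eqP; rewrite eq_le; apply/andP; split.
  apply: ge_ereal_sup => _ [ms /= am <-].
  have [es Ees le] := water_run_half (fun u => Y u t) v am.
  apply: (@le_trans _ _ (h (code es) t)).
    by rewrite /h -((eP (code es)).2 es Ees erefl) lee_fin.
  by apply: ereal_sup_ubound; exists (code es).
apply: ge_ereal_sup => _ [n _ <-]; apply: kappa_ge_run.
have [Een _] := eP n; rewrite all_map; apply: sub_all Een => -[x y] /= Exy.
by rewrite admissible_half.
Qed.

End Measurability.

(** * Transport along an isomorphism with the line *)

Section Transport.
Variables (V : choiceType) (E : rel V) (R : realType) (f : int -> V).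
Hypothesis f_iso : graph_isomorphism line_graph E f.

Lemma line_kappa_le (eta : V -> R) (tau : R) : 0 < tau -> (forall u, eta u <= 1) ->
  rarely_low tau (fun n => 1 - eta (f (Posz n))) ->
  rarely_low tau (fun n => 1 - eta (f (Negz n))) ->
  (kappa E eta (f 0) <= (1 - tau / 2)%:E)%E.
Proof.
move=> tau0 eta1 Hp Hn; have [[g fK gK] fE] := f_iso.
pose tr (m : move V R) : move int R := ((g m.1.1, g m.1.2), m.2).
have trE ms : forall eta' z,
    water_run eta' ms (f z) = water_run (eta' \o f) (map tr ms) z.
  elim: ms => [//|m ms IH] eta' z.
  rewrite -[LHS]/(water_run (water_step eta' m) ms (f z)) IH.
  rewrite (_ : _ \o f = water_step (eta' \o f) (tr m)) //; apply/funext => w.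
  case: m => [[x y] mu] /=; rewrite !gK.
  by rewrite !(can2_eq fK gK).
apply: ge_ereal_sup => _ [ms /= am <-]; rewrite lee_fin trE.
apply: line_run_le => //.
  rewrite all_map; apply: sub_all am => -[[x y] mu] /andP[/= Exy mu01].
  by rewrite /admissible /= -fE !gK Exy.
by move=> z; exact: eta1.
Qed.

End Transport.

Lemma line_iso_at (V : choiceType) (E : rel V) v : graph_isomorphic line_graph E ->
  exists2 f, graph_isomorphism line_graph E f & f 0 = v.
Proof.
move=> [f [[g fK gK] fE]]; exists (fun z => f (z + g v)); last by rewrite add0r gK.
split; first by exists (fun w => g w - g v) => z; rewrite ?fK ?addrK ?subrK ?gK.
move=> u w; rewrite fE /line_graph.
by rewrite addrAC (inj_eq (addIr _)) [w + g v + 1]addrAC (inj_eq (addIr _)).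
Qed.

(** * High levels are rare on both half-lines with positive probability *)

Section LineProbability.
Variables (V : choiceType) (E : rel V) (d : measure_display).
Variables (T : measurableType d) (R : realType) (P : probability T R).
Variables (X : V -> {RV P >-> R}).
Hypothesis Xiid : iid_uniform01 X.

(* With p = 1 / (4 ^ 6 - 1) the weights 4 ^ 6 have mean 2, so that more than
   n / 6 exceedances among n sites have probability at most 2 ^ n / 4 ^ n. *)
Let q : R := 4 ^+ 6.
Let p : R := (q - 1)^-1.

(** The weight is [4 ^ (6 c)] with [c] the number of the first [n] levels above [1 - p], so the
    event says [n <= 6 c]. *)
Definition crowded (u : nat -> V) n : set T :=
  [set t | 4 ^+ n <= weight X (1 - p) (fun=> q) [seq u i | i <- iota 0 n] t].

Lemma measurable_crowded u n : measurable (crowded u n).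
Proof. exact: measurable_weight_ge. Qed.

Let p01 : 0 < p <= 1.
Proof.
have h : 1 <= q - 1 by rewrite /q; lra.
by rewrite invr_gt0 (lt_le_trans ltr01 h) invf_le1 // (lt_le_trans ltr01 h).
Qed.

Lemma pr_crowded u n : injective u -> pr P (crowded u n) <= (2 ^+ n)^-1.
Proof.
move=> uI; have [Xind _] := Xiid; have /andP[p0 p1] := p01.
have Xp w : pr P (X w @^-1` `]1 - p, +oo[) = p.
  by rewrite iid_pr_gt // ?subKr // subr_ge0 p1 gerBl ltW.
have uq : uniq [seq u i | i <- iota 0 n] by rewrite map_inj_uniq ?iota_uniq.
have n4 : 0 < 4 ^+ n :> R by rewrite exprn_gt0.
have q0 : 0 < q by rewrite exprn_gt0.
have := @markov_weight _ _ _ _ _ _ Xind (1 - p) p Xp (fun=> q) _ _ (fun=> q0) uq n4.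
rewrite prod_map_iota prodr_const card_ord.
have -> : 1 + (q - 1) * p = 2.
  by rewrite /p divff; [lra|rewrite /q; lra].
rewrite -/(crowded u n) => h.
have -> : (2 ^+ n)^-1 = 2 ^+ n / 4 ^+ n :> R.
  have -> : 4 = 2 * 2 :> R by lra.
  by rewrite exprMn invfM mulrA divff ?mul1r // expf_neq0.
by rewrite ler_pdivlMr // mulrC.
Qed.

Lemma not_crowded u n t : ~ crowded u n t ->
  6 * \sum_(i < n) (1 - p < X (u i) t)%R%:R <= n%:R :> R.
Proof.
move=> /negP; rewrite -ltNge /weight prod_map_iota.
pose c := (\sum_(i < n) (1 - p < X (u i) t)%R)%N.
have -> : \prod_(j < n) (if 1 - p < X (u j) t then q else 1) = 4 ^+ (6 * c).
  rewrite exprM /c; elim: (n) => [|m IH]; first by rewrite !big_ord0.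
  rewrite !big_ord_recr /= exprD IH; congr (_ * _).
  by case: ifP => _; rewrite ?expr1 ?expr0.
rewrite ltr_eXn2l ?ltr1n // => /ltnW h.
by rewrite -natr_sum -natrM ler_nat.
Qed.

(** Prefixes of length at least 3 are controlled by the events, since [tau <= p] makes every low
    site an exceedance of [1 - p]. Shorter prefixes have no low site at all. *)
Lemma crowded_rarely_low (u : nat -> V) t tau : tau <= p ->
  (forall n, (3 <= n)%N -> ~ crowded u n t) ->
  (forall n, (n < 3)%N -> tau <= 1 - X (u n) t) ->
  rarely_low tau (fun n => 1 - X (u n) t).
Proof.
move=> taup H3 Hs n; have [n3|n3] := leqP 3 n.
  apply: le_trans (not_crowded (H3 n n3)).
  rewrite ler_pM2l //; apply: ler_sum => i _; rewrite ler_nat /low.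
  case: (ltP (1 - X (u i) t) tau) => // lt.
  by rewrite (_ : 1 - p < X (u i) t) //; lra.
rewrite big1 ?mulr0 // => i _; rewrite /low ltNge Hs //.
exact: ltn_trans n3.
Qed.

Variables (v : V) (f : int -> V).
Hypotheses (f_iso : graph_isomorphism line_graph E f) (f0 : f 0 = v).
Hypothesis cV : countable [set: V].

(** Off the union of the crowded events [kappa] is almost surely below 1, and a union bound gives
    this union probability at most 1/2. *)
Lemma not_ae_kappa_ge1 :
  ~ {ae P, forall t, (1 <= kappa E (fun u => X u t) v)%E}.
Proof.
move=> k1; have [[g fK _] _] := f_iso; have fI := can_inj fK.
pose up n := f (Posz n); pose un n := f (Negz n).
have upI : injective up by move=> i j /fI[].
have unI : injective un by move=> i j /fI[].
(* Starting at length 3 makes the total bound over both sides [2 * (1/8 + 1/16 + ...) = 1/2]. *)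
pose B n := crowded up n.+3 `|` crowded un n.+3.
have mB n : measurable (B n) by apply: measurableU; exact: measurable_crowded.
have mU : measurable (\bigcup_n B n) by exact: bigcupT_measurable.
have PU : (P (\bigcup_n B n) <= (2^-1)%:E)%E.
  apply: le_trans (_ : (\sum_(0 <= n <oo) P (B n) <= _)%E).
    by apply: measure_sigma_subadditive => // n.
  apply: le_trans (epsilon_trick0 xpredT _); last by rewrite invr_ge0.
  apply: lee_nneseries => // n _; rewrite prE // lee_fin.
  apply: le_trans (prU _ _ _) _; [exact: measurable_crowded..|].
  apply: le_trans (lerD (pr_crowded _ upI) (pr_crowded _ unI)) _.
  rewrite natrX !exprS !invfM.
  by move: ((2 ^+ n)^-1) => y; lra.
have : {ae P, forall t, (\bigcup_n B n) t}.
  have hb := ae_countable cV (iid_bounds Xiid).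
  apply: filterS2 hb k1 => t bt kt; apply: contrapT => nB.
  have nc n : (3 <= n)%N -> ~ crowded up n t /\ ~ crowded un n t.
    case: n => [|[|[|n]]] // _; split => h; apply: nB; exists n => //.
      by left.
    by right.
  have X1 u : X u t < 1 by have /andP[] := bt u.
  have /andP[p0 _] := p01.
  (* [tau] depends on the realisation: it is small enough that none of the three nearest sites on
     either side is low. *)
  pose tau := Num.min p (\big[Num.min/1]_(i < 3)
     Num.min (1 - X (up i) t) (1 - X (un i) t)).
  have tau0 : 0 < tau.
    rewrite lt_min p0 /=; apply: (big_ind (fun x : R => 0 < x)) => // [x y x0 y0|i _].
      by rewrite lt_min x0.
    by rewrite lt_min !subr_gt0 !X1.
  have taui n : (n < 3)%N -> tau <= 1 - X (up n) t /\ tau <= 1 - X (un n) t.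
    move=> n3; have : tau <= Num.min (1 - X (up n) t) (1 - X (un n) t).
      by rewrite /tau ge_min (bigmin_le_cond _ _ (j := Ordinal n3)) // orbT.
    by rewrite le_min => /andP[].
  have taup : tau <= p by rewrite ge_min lexx.
  have := @line_kappa_le V E R f f_iso (fun u => X u t) tau tau0
    (fun u => ltW (X1 u))
    (crowded_rarely_low taup (fun n n3 => (nc n n3).1) (fun n n3 => (taui n n3).1))
    (crowded_rarely_low taup (fun n n3 => (nc n n3).2) (fun n n3 => (taui n n3).2)).
  rewrite f0 => /(le_trans kt); rewrite lee_fin.
  by move: tau0; lra.
move=> /negligibleP /= => /(_ (measurableC mU)) h.
have := prC P mU; rewrite {1}/pr h /= => /eqP.
rewrite eq_sym subr_eq0 => /eqP e1.
by move: PU; rewrite prE // -e1 lee_fin; lra.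
Qed.

(** As [kappa] is at least the initial level at [v], which exceeds any [a < 1] with positive
    probability, an almost sure value would be at least 1. *)
Lemma line_kappa_nondegenerate :
  nondegenerate_random_variable P (fun t => kappa E (fun u => X u t) v).
Proof.
split; first by apply: measurable_kappa.
move=> [c kc]; apply: not_ae_kappa_ge1.
have ge (a : R) : 0 <= a < 1 -> (a%:E <= c)%E.
  move=> /andP[a0 a1]; rewrite leNgt; apply/negP => ca.
  have mA : measurable (X v @^-1` `]a, +oo[) by exact: mX (measurable_itv _).
  have : pr P (X v @^-1` `]a, +oo[) = 0.
    have : P.-negligible (X v @^-1` `]a, +oo[).
      apply: negligibleS kc => t /=; rewrite in_itv /= andbT => at_ /= e.
      have := kappa_ge_init E (fun u => X u t) v; rewrite e leNgt.
      by rewrite (lt_trans ca) // lte_fin.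
    by move=> /negligibleP h; rewrite /pr h.
  rewrite iid_pr_gt // ?a0 ?ltW //.
  by move/eqP; rewrite subr_eq0 => /eqP e; move: a1; rewrite -e ltxx.
have c1 : (1 <= c)%E.
  case: (c) ge => [r| |] ge; last 2 first.
  - exact: leey.
  - by have := ge 0; rewrite lexx ltr01 => /(_ isT).
  rewrite lee_fin leNgt; apply/negP => r1.
  have := ge 0; rewrite lexx ltr01 lee_fin => /(_ isT) r0.
  have := ge ((r + 1) / 2); rewrite lee_fin => h.
  by have := h ltac:(lra); lra.
by apply: filterS kc => t ->.
Qed.

End LineProbability.

(** * The two cases combined *)

Unset Implicit Arguments.

Theorem theorem5p3 (V : choiceType) (E : rel V)
    (d : measure_display) (T : measurableType d) (R : realType)
    (P : probability T R) (eta0 : V -> {RV P >-> R}) (v : V)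
    (Vinf : infinite_set [set: V])
    (Esimple : simple_graph E)
    (Econn : graph_connected E)
    (Eqt : quasi_transitive E)
    (Edeg : bounded_degree E)
    (eta0_iid : iid_uniform01 eta0) :
  (graph_isomorphic line_graph E ->
     nondegenerate_random_variable P
       (fun t => kappa E (fun u => eta0 u t) v)) /\
  (~ graph_isomorphic line_graph E ->
     {ae P, forall t, kappa E (fun u => eta0 u t) v = 1%E}).
Proof.
have [Esym Eirr] := Esimple; split.
  move=> /(line_iso_at v)[f f_iso f0].
  have cV := vertices_countable Edeg v Econn.
  exact: (line_kappa_nondegenerate eta0_iid f_iso f0 cV).
move=> nline.
have [w0 w0d] : exists w0, ~ degree_two E w0.
  apply: contrapT => no; apply: nline; apply: degree_two_line v _ => // u.
  by apply: contrapT => nu; apply: no; exists u.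
exact: (kappa_eq1_ae v Esym Eirr Vinf Econn Eqt Edeg eta0_iid w0d).
Qed.
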